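(* Let $X\subset\mathbb R^m$ be compact with finite intrinsic distance $d_X$ on $X\times X$, let $f\colon X\to\mathbb R$ be continuous with $(X,f)$ a constructible $\mathbb R$-space, let $\omega_f$ be a fixed non-decreasing modulus of continuity of $f$ with respect to $d_X$, and let $R=\mathfrak R(X,f)$. Let $P$ be a probability measure on $\mathbb R^m$ with support $X$ satisfying the $(a,b)$-standard assumption in the Euclidean metric for some $a,b>0$: $$P(B_{\|\cdot\|}(x,r))\ge\min\{ar^b,1\}\qquad\text{for all }x\in X,\ r>0 .$$ Let $S_n=\{X_1,\dots,X_n\}$ be an i.i.d. sample from $P$, and suppose that $X$ has positive reach $\tau=\mathrm{rch}(X)>0$. Then, for every $\delta\in(0,\tau)$, $$\mathbb P\Bigl(d_I\bigl(\mathcal F_R,\mathcal R_\delta^{S_n,\|\cdot\|}\bigr)\le\omega_f(\eta_\tau(\delta))\Bigr)\ge1-\alpha_\delta,$$ where $$\eta_\tau(\delta)=2\tau\arcsin\Bigl(\frac\delta\tau\Bigr),\qquad \alpha_\delta=\min\Bigl\{1,\frac{4^b}{a\delta^b}\exp\Bigl(-a\bigl(\tfrac\delta2\bigr)^bn\Bigr)\Bigr\}.$$ If $f$ is $1$-Lipschitz with respect to $d_X$ and $2\delta<\tau$, then $\omega_f(\eta_\tau(\delta))$ can be replaced by $(2\pi/3)\delta$ in this inequality.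
   Context: **Intrinsic distance and reach.** $d_X(x,y)$ is the infimum of the lengths (suprema of Euclidean polygonal sums) of continuous paths in $X$ from $x$ to $y$ ($+\infty$ if there is no path). The reach $\mathrm{rch}(X)$ is the infimum of $\mathrm{dist}(z,X)$ over points $z\in\mathbb R^m$ having more than one closest point in $X$. $B_{\|\cdot\|}(x,r)$ is the closed Euclidean ball. **Constructible $\mathbb R$-spaces.** $(X,f)$, $f\colon X\to\mathbb R$ continuous, is constructible if it is isomorphic over $\mathbb R$ to a space built from finitely many reals $a_0<\dots<a_n$, compact locally path-connected spaces $V_0,\dots,V_n$, $E_0,\dots,E_{n-1}$ and continuous maps $l_i\colon E_i\to V_i$, $r_i\colon E_i\to V_{i+1}$ as the quotient of $\bigsqcup_i V_i\times\{a_i\}\sqcup\bigsqcup_iE_i\times[a_i,a_{i+1}]$ by $(x,a_i)\sim(l_i(x),a_i)$, $(x,a_{i+1})\sim(r_i(x),a_{i+1})$, with $f$ the second projection. The Reeb graph $\mathfrak R(X,f)=(X/\!\sim_f,\bar f)$ identifies points lying in the same path component of a level set of $f$. **Cosheaves and interleaving distance.** $\mathbf{Int}$ is the poset category of open intervals of $\mathbb R$. For an $\mathbb R$-space $(Y,g)$, $\mathcal F_{(Y,g)}(I)=\pi_0(g^{-1}(I))$, with maps induced by inclusion; $\mathcal F_R$ is this functor for the Reeb graph $R$, and it is canonically isomorphic to $\mathcal F_{(X,f)}$. For $I=(a,b)$ put $I^\varepsilon=(a-\varepsilon,b+\varepsilon)$ and $\mathcal S_\varepsilon(\mathcal G)(I)=\mathcal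 G(I^\varepsilon)$. An $\varepsilon$-interleaving of $\mathcal F,\mathcal G$ is a pair of natural transformations $\varphi\colon\mathcal F\Rightarrow\mathcal S_\varepsilon\mathcal G$, $\psi\colon\mathcal G\Rightarrow\mathcal S_\varepsilon\mathcal F$ such that $\mathcal S_\varepsilon(\psi)\circ\varphi$ and $\mathcal S_\varepsilon(\varphi)\circ\psi$ are the canonical transformations induced by $I\subseteq I^{2\varepsilon}$. $d_I(\mathcal F,\mathcal G)$ is the infimum of such $\varepsilon\ge0$. **Modulus.** $\omega_f\colon[0,\infty)\to[0,\infty)$ is non-decreasing with $\omega_f(0)=0$ and $|f(x)-f(y)|\le\omega_f(d_X(x,y))$ for all $x,y\in X$. **PL-Reeb estimator.** $\Gamma_\delta^{S_n,\|\cdot\|}$ is the graph with vertex set $S_n$ in which distinct $x,y$ are joined by an edge iff $\|x-y\|\le2\delta$. $\hat f_n^{\|\cdot\|}$ is the extension of $f|_{S_n}$ to the geometric realization that is affine on each edge. $\mathcal R_\delta^{S_n,\|\cdot\|}$ is the functor $I\mapsto\pi_0\bigl((\hat f_n^{\|\cdot\|})^{-1}(I)\bigr)$. *)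

(* Defs.v *)
From HB Require Import structures.
From Stdlib Require Import Relation_Operators Relation_Definitions.
From mathcomp Require Import all_boot all_order all_algebra.
From mathcomp Require Import generic_quotient.
From mathcomp Require Import all_classical all_reals all_analysis.
From mathcomp Require Import lra.

Set Implicit Arguments.
Unset Strict Implicit.
Unset Printing Implicit Defensive.

Import Order.TTheory GRing.Theory Num.Theory.
Import numFieldNormedType.Exports.

Local Open Scope quotient_scope.
Local Open Scope classical_set_scope.
Local Open Scope ring_scope.

Section Paths.
Context {R : realType} {T : topologicalType}.
Implicit Types (A B : set T) (p q : R -> T).

(* Only the restriction of p to [0, 1] matters. *)
Definition is_path_in A p (x y : T) : Prop :=
  [/\ {within `[0, 1], continuous p}, p 0 = x, p 1 = y &
      forall t, t \in `[0, 1] -> A (p t)].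

Definition joined A (x y : T) : Prop := exists p, is_path_in A p x y.

Definition path_connected A : Prop := forall x y, A x -> A y -> joined A x y.

Lemma joined_refl A x : A x -> joined A x x.
Proof.
move=> Ax; exists (fun=> x); split => //.
by apply: continuous_subspaceT => t; exact: cvg_cst.
Qed.

Lemma within_affine_comp (a b c e : R) (p : R -> T) :
  (forall t, t \in `[a, b] -> c * t + e \in `[0, 1]) ->
  {within `[0, 1], continuous p} ->
  {within `[a, b], continuous (fun t => p (c * t + e))}.
Proof.
move=> abI /subspace_sigL_continuousP cp; apply/subspace_sigL_continuousP.
pose g (t : `[a, b]%classic) : `[0 : R, 1]%classic :=
  exist _ (c * set_val t + e) (mem_set (abI _ (set_mem (valP t)))).
have cg : continuous g.
  apply/continuousP => _ [U oU <-].
  have /continuousP cf : continuous (fun s : R => c * s + e).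
    move=> s; apply: cvgD; last exact: cvg_cst.
    by apply: cvgM; [exact: cvg_cst|exact: cvg_id].
  by exists ((fun s => c * s + e) @^-1` U) => //; exact: cf.
rewrite (_ : sigL _ _ = sigL `[0, 1]%classic p \o g)//.
by move=> t; apply: continuous_comp; [exact: cg|exact: cp].
Qed.

Lemma joined_sym A x y : joined A x y -> joined A y x.
Proof.
move=> [p [cp p0 p1 pA]]; exists (fun t => p (-1 * t + 1)); split.
- by apply: within_affine_comp => // t; rewrite !in_itv/= => /andP[? ?]; lra.
- by rewrite mulr0 add0r.
- by rewrite mulr1 addNr.
- by move=> t tI; apply: pA; move: tI; rewrite !in_itv/= => /andP[? ?]; lra.
Qed.

Lemma joined_trans A x y z : joined A x y -> joined A y z -> joined A x z.
Proof.
move=> [p [cp p0 p1 pA]] [q [cq q0 q1 qA]].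
pose r t := if t <= 2^-1 then p (2 * t + 0) else q (2 * t + -1).
have rp t : t \in `[0, 2^-1] -> p (2 * t + 0) = r t.
  by rewrite in_itv/= /r => /andP[_ ->].
have rq t : t \in `[2^-1, 1] -> q (2 * t + -1) = r t.
  rewrite in_itv/= /r => /andP[h _]; case: ifPn => // h'.
  have -> : t = 2^-1 by lra.
  by rewrite addr0 mulfV// p1 subrr q0.
have cr1 : {within `[0, 2^-1], continuous r}.
  have E : {in `[0, 2^-1]%classic, (fun t : R => p (2 * t + 0)) =1 r}.
    by move=> t; rewrite inE/= => /rp.
  apply: (subspace_eq_continuous E).
  by apply: within_affine_comp => // t; rewrite !in_itv/= => /andP[? ?]; lra.
have cr2 : {within `[2^-1, 1], continuous r}.
  have E : {in `[2^-1, 1]%classic, (fun t : R => q (2 * t + -1)) =1 r}.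
    by move=> t; rewrite inE/= => /rq.
  apply: (subspace_eq_continuous E).
  by apply: within_affine_comp => // t; rewrite !in_itv/= => /andP[? ?]; lra.
exists r; split.
- have -> : `[0, 1]%classic = `[0, 2^-1]%classic `|` `[2^-1, 1]%classic :> set R.
    by apply/seteqP; split => t /=; rewrite !in_itv/=; [move=> ?; lra|case; lra].
  by apply: withinU_continuous => //; exact: interval_closed.
- by rewrite -rp ?mulr0 ?addr0// in_itv/=; lra.
- rewrite -rq; last by rewrite in_itv/=; lra.
  by rewrite mulr1 (_ : 2 + -1 = 1)//; lra.
- move=> t; rewrite in_itv/= /r => h.
  by case: ifPn => h'; [apply: pA|apply: qA]; rewrite in_itv/=; lra.
Qed.

Lemma sub_joined A B x y : A `<=` B -> joined A x y -> joined B x y.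
Proof. by move=> AB [p [? ? ? pA]]; exists p; split => // t /pA/AB. Qed.

End Paths.

Section QuotientBy.
Context {T : choiceType} (r : T -> T -> Prop).
Hypotheses (r_refl : forall x, r x x)
  (r_sym : forall x y, r x y -> r y x)
  (r_trans : forall x y z, r x y -> r y z -> r x z).

Let rb (x y : T) : bool := `[< r x y >].

Let rb_refl : reflexive rb.
Proof. by move=> x; apply/asboolP. Qed.

Let rb_sym : symmetric rb.
Proof. by move=> x y; apply/asboolP/asboolP => /r_sym. Qed.

Let rb_trans : transitive rb.
Proof.
by move=> y x z /asboolP xy /asboolP yz; apply/asboolP; exact: r_trans yz.
Qed.

Definition equiv_of : equiv_rel T := EquivRel rb rb_refl rb_sym rb_trans.

End QuotientBy.

Section Pi0.
Context (R : realType) {T : topologicalType} (A : set T).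

Definition pi0_rel : equiv_rel A :=
  @equiv_of A (fun x y => @joined R T A (set_val x) (set_val y))
    (fun x => @joined_refl R T A _ (set_mem (valP x)))
    (fun x y => @joined_sym R T A _ _)
    (fun x y z => @joined_trans R T A _ _ _).

Definition pi0 := {eq_quot pi0_rel}.

End Pi0.

Section Pi0Map.
Context (R : realType) {T : topologicalType}.
Implicit Types A B C : set T.

Definition incl A B (AB : A `<=` B) (x : A) : B :=
  exist _ (set_val x) (mem_set (AB _ (set_mem (valP x)))).

Definition pi0_map A B (AB : A `<=` B) (c : pi0 R A) : pi0 R B :=
  \pi_(pi0 R B) (incl AB (repr c)).

Lemma pi0_eqP A (x y : A) :
  \pi_(pi0 R A) x = \pi_(pi0 R A) y <-> @joined R T A (set_val x) (set_val y).
Proof.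
split; first by move/eqP; rewrite eqmodE => /asboolP.
by move=> xy; apply/eqP; rewrite eqmodE; apply/asboolP.
Qed.

Lemma pi0_mapE A B (AB : A `<=` B) (x : A) :
  pi0_map AB (\pi_(pi0 R A) x) = \pi_(pi0 R B) (incl AB x).
Proof.
apply/pi0_eqP; apply: (sub_joined AB); apply/pi0_eqP; exact: reprK.
Qed.

Lemma pi0_map_id A (AA : A `<=` A) (c : pi0 R A) : pi0_map AA c = c.
Proof.
rewrite -[c in RHS]reprK; congr (\pi _); exact: val_inj.
Qed.

Lemma pi0_map_comp A B C (AB : A `<=` B) (BC : B `<=` C) (AC : A `<=` C)
  (c : pi0 R A) : pi0_map AC c = pi0_map BC (pi0_map AB c).
Proof. by rewrite pi0_mapE; congr (\pi _); exact: val_inj. Qed.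

End Pi0Map.

(* Nonempty open intervals of the real line; the endpoints may be infinite. *)
Record open_itv (R : realType) := OpenItv {
  lo : \bar R;
  hi : \bar R;
  lo_lt_hi : (lo < hi)%E }.

Coercion itv_set {R : realType} (I : open_itv R) : set R :=
  [set x | (lo I < x%:E < hi I)%E].

Section Thicken.
Context {R : realType}.
Local Open Scope ereal_scope.
Implicit Types (I J : open_itv R) (e : {nonneg R}).

Lemma thicken_proof I e : lo I - e%:num%:E < hi I + e%:num%:E.
Proof.
have e0 : 0 <= e%:num%:E by rewrite lee_fin.
apply: lt_le_trans (leeDl _ e0); apply: le_lt_trans (lo_lt_hi I).
by rewrite leeBlDr// leeDl.
Qed.

Definition thicken I e : open_itv R := OpenItv (thicken_proof I e).

Lemma ereal_between (x y : \bar R) : x < y -> exists r : R, x < r%:E < y.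
Proof.
case: x y => [x||] [y||]//= xy.
- by exists ((x + y) / 2)%R; rewrite !lte_fin in xy *; apply/andP; split; lra.
- by exists (x + 1)%R; rewrite ltry andbT lte_fin ltrDl.
- by exists (y - 1)%R; rewrite ltNyr lte_fin gtrBl ltr01.
- by exists 0%R; rewrite ltNyr ltry.
Qed.

Lemma itv_subP I J : (I `<=` J)%classic <-> lo J <= lo I /\ hi I <= hi J.
Proof.
split=> [IJ|[IJlo IJhi] x /= /andP[lx xh]]; last first.
  by apply/andP; split; [exact: le_lt_trans lx|exact: lt_le_trans IJhi].
split; rewrite leNgt; apply/negP => lt.
- have : lo I < Order.min (lo J) (hi I) by rewrite lt_min lt lo_lt_hi.
  move=> /ereal_between[x]; rewrite lt_min => /and3P[Ix xJ xI].
  have /andP[+ _] : itv_set J x by apply: IJ; apply/andP; split.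
  by rewrite ltNge (ltW xJ).
- have : Order.max (hi J) (lo I) < hi I by rewrite gt_max lt lo_lt_hi.
  move=> /ereal_between[x]; rewrite gt_max => /andP[/andP[Jx Ix] xI].
  have /andP[_ +] : itv_set J x by apply: IJ; apply/andP; split.
  by rewrite ltNge (ltW Jx).
Qed.

Lemma sub_thicken I e : (I `<=` thicken I e)%classic.
Proof.
have e0 : 0 <= e%:num%:E by rewrite lee_fin.
apply/itv_subP; split; last by rewrite leeDl.
by rewrite -[lo _]/(lo I - e%:num%:E) leeBlDr// leeDl.
Qed.

Lemma thickenS I J e :
  (I `<=` J)%classic -> (thicken I e `<=` thicken J e)%classic.
Proof.
by move=> /itv_subP[? ?]; apply/itv_subP; split; rewrite /= ?leeB// leeD.
Qed.

End Thicken.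

(* Functors from the poset of open intervals, ordered by inclusion, to sets. *)
Record precosheaf (R : realType) := Precosheaf {
  cosh_obj :> open_itv R -> Type;
  cosh_map : forall I J : open_itv R, I `<=` J -> cosh_obj I -> cosh_obj J;
  cosh_map_id : forall (I : open_itv R) (II : I `<=` I) x, cosh_map II x = x;
  cosh_map_comp : forall (I J K : open_itv R)
      (IJ : I `<=` J) (JK : J `<=` K) (IK : I `<=` K) x,
    cosh_map IK x = cosh_map JK (cosh_map IJ x) }.

Arguments cosh_map {R} p {I J} _ _.

Section Interleaving.
Context {R : realType}.
Implicit Types (F G : precosheaf R) (e : {nonneg R}).

Definition shift e G : precosheaf R :=
  @Precosheaf R (fun I => G (thicken I e))
    (fun I J IJ => cosh_map G (thickenS (e := e) IJ))
    (fun I II x => cosh_map_id (thickenS (e := e) II) x)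
    (fun I J K IJ JK IK x => cosh_map_comp (thickenS (e := e) IJ)
      (thickenS (e := e) JK) (thickenS (e := e) IK) x).

Definition natural F G (phi : forall I, F I -> G I) : Prop :=
  forall (I J : open_itv R) (IJ : I `<=` J) x,
    phi J (cosh_map F IJ x) = cosh_map G IJ (phi I x).

Lemma sub_thicken2 (I : open_itv R) e : I `<=` thicken (thicken I e) e.
Proof. exact: subset_trans (@sub_thicken R I e) (@sub_thicken R _ e). Qed.

(* The interval of radius 2e around I is written as the e-thickening of the
   e-thickening of I, so that no transport along an equality is needed. *)
Definition interleaved e F G : Prop :=
  exists (phi : forall I, F I -> shift e G I)
         (psi : forall I, G I -> shift e F I),
    [/\ natural phi, natural psi,
       forall I x, psi (thicken I e) (phi I x) = cosh_map F (@sub_thicken2 I e) x &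
       forall I y, phi (thicken I e) (psi I y) = cosh_map G (@sub_thicken2 I e) y].

Definition interleaving_dist F G : \bar R :=
  ereal_inf [set e%:num%:E | e in [set e : {nonneg R} | interleaved e F G]].

End Interleaving.

Section RSpaces.
Context {R : realType}.

(* I |-> pi_0 (g^-1 I) for an R-space (Y, g). *)
Definition pi0_precosheaf (Y : topologicalType) (g : Y -> R) : precosheaf R :=
  @Precosheaf R (fun I => pi0 R (g @^-1` I))
    (fun I J IJ => pi0_map (preimage_subset (f := g) IJ))
    (fun I II x => pi0_map_id _ x)
    (fun I J K IJ JK IK x => pi0_map_comp _ _ _ x).

Section ReebGraph.
Context {Y : topologicalType} (g : Y -> R).

(* joined A x y forces x and y to lie in A, here the level set of g at g x. *)
Definition same_level_component (x y : Y) : Prop :=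
  @joined R Y [set z | g z = g x] x y.

Lemma same_level_component_refl x : same_level_component x x.
Proof. exact: joined_refl. Qed.

Lemma same_level_componentE x y : same_level_component x y -> g y = g x.
Proof. by move=> [p [_ _ <- pA]]; apply: pA; rewrite in_itv/= ler01 lexx. Qed.

Lemma same_level_component_sym x y :
  same_level_component x y -> same_level_component y x.
Proof.
by move=> xy; rewrite /same_level_component (same_level_componentE xy);
  exact: joined_sym.
Qed.

Lemma same_level_component_trans x y z :
  same_level_component x y -> same_level_component y z ->
  same_level_component x z.
Proof.
move=> xy; rewrite {1}/same_level_component (same_level_componentE xy).
exact: joined_trans.
Qed.

Definition reeb_rel : equiv_rel Y :=
  equiv_of same_level_component_refl same_level_component_sym
    same_level_component_trans.

Definition reeb_graph : topologicalType :=
  quotient_topology {eq_quot reeb_rel}.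

Definition reeb_fun (q : reeb_graph) : R := g (repr (q : {eq_quot reeb_rel})).


Definition reeb_precosheaf : precosheaf R := pi0_precosheaf reeb_fun.

Lemma reeb_funE x : reeb_fun (\pi_({eq_quot reeb_rel}) x) = g x.
Proof.
apply/esym/same_level_componentE.
have /eqP := reprK (\pi_({eq_quot reeb_rel}) x).
by rewrite eqmodE => /asboolP.
Qed.

End ReebGraph.
End RSpaces.

Arguments reeb_fun {R Y} g q.

Section Constructible.
Context {R : realType}.

Definition locally_path_connected (T : topologicalType) : Prop :=
  forall (x : T) (U : set T), nbhs x U ->
    exists W, [/\ open W, W x, W `<=` U & @path_connected R T W].

Definition iso_over (Y Z : topologicalType) (g : Y -> R) (h : Z -> R) : Prop :=
  exists (u : Y -> Z) (v : Z -> Y),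
    [/\ continuous u, continuous v, cancel u v, cancel v u & h \o u = g].

Section Model.
Context {n : nat} (a : 'I_n.+1 -> R).
Context (V : 'I_n.+1 -> topologicalType) (E : 'I_n -> topologicalType).

Local Notation fstv i := (widen_ord (leqnSn n) i).
Local Notation sndv i := (lift ord0 i).

Context (l : forall i, E i -> V (fstv i)) (r : forall i, E i -> V (sndv i)).

Definition piece_base (k : 'I_n.+1 + 'I_n) : topologicalType :=
  match k with inl i => V i | inr i => E i end.

Definition piece_range (k : 'I_n.+1 + 'I_n) : set R :=
  match k with
  | inl i => [set a i]
  | inr i => `[a (fstv i), a (sndv i)]%classic
  end.

Definition piece k : topologicalType := (piece_base k * piece_range k)%type.

Definition pieces : topologicalType := {k & piece k}.

(* A point of piece_range (inl i) is the real a i; quantifying over it avoids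
   exhibiting membership proofs. *)
Inductive glue : pieces -> pieces -> Prop :=
| glue_left i (x : E i) (s : piece_range (inr i))
    (t : piece_range (inl (fstv i))) :
    set_val s = a (fstv i) ->
    glue (existT piece (inr i) (x, s)) (existT piece (inl (fstv i)) (l x, t))
| glue_right i (x : E i) (s : piece_range (inr i))
    (t : piece_range (inl (sndv i))) :
    set_val s = a (sndv i) ->
    glue (existT piece (inr i) (x, s)) (existT piece (inl (sndv i)) (r x, t)).

Definition glue_rel : equiv_rel pieces :=
  @equiv_of pieces (clos_refl_sym_trans pieces glue)
    (@rst_refl _ _) (@rst_sym _ _) (@rst_trans _ _).

Definition model : topologicalType := quotient_topology {eq_quot glue_rel}.

Definition piece_height (p : pieces) : R := set_val (tagged p).2.

Definition model_fun (q : model) : R :=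
  piece_height (repr (q : {eq_quot glue_rel})).

Lemma model_funE p : model_fun (\pi_({eq_quot glue_rel}) p) = piece_height p.
Proof.
have /eqP := reprK (\pi_({eq_quot glue_rel}) p).
rewrite eqmodE /model_fun => /asboolP; set q := repr _.
elim => //=.
- move=> _ _ [i x s t|i x s t] st; rewrite /piece_height/= st;
    exact/esym/(set_mem (valP t)).
- by move=> x y z _ -> _ ->.
Qed.

End Model.

Definition constructible (Y : topologicalType) (g : Y -> R) : Prop :=
  exists (n : nat) (a : 'I_n.+1 -> R)
    (V : 'I_n.+1 -> topologicalType) (E : 'I_n -> topologicalType)
    (l : forall i, E i -> V (widen_ord (leqnSn n) i))
    (r : forall i, E i -> V (lift ord0 i)),
  [/\ forall i j : 'I_n.+1, (i < j)%N -> a i < a j,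
      forall i, compact [set: V i] /\ locally_path_connected (V i),
      forall i, compact [set: E i] /\ locally_path_connected (E i),
      forall i, continuous (l i) /\ continuous (r i) &
      iso_over g (model_fun (a := a) (l := l) (r := r))].

End Constructible.

Section Euclidean.
Context {R : realType} {m : nat}.
Implicit Types (X : set 'rV[R]_m) (x y z : 'rV[R]_m) (p : R -> 'rV[R]_m).

(* The library norm on row vectors is the sup norm. *)
Definition enorm x : R := Num.sqrt (\sum_(i < m) x ord0 i ^+ 2).

Definition closed_eball x (r : R) : set 'rV[R]_m := [set y | enorm (y - x) <= r].

Definition polygonal_sum p (s : seq R) : R :=
  let q := p \o nth 1 (0 :: s) in
  \sum_(0 <= k < size s) enorm (q k.+1 - q k).

Definition path_length p : \bar R :=
  ereal_sup [set (polygonal_sum p s)%:E | s in itv_partition 0 1].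

Definition intrinsic_dist X x y : \bar R :=
  ereal_inf [set path_length p | p in [set p | is_path_in X p x y]].

Definition edist_set z X : R := inf [set enorm (z - x) | x in X].

Definition closest_point X z x : Prop := X x /\ enorm (z - x) = edist_set z X.

Definition reach X : \bar R :=
  ereal_inf [set (edist_set z X)%:E | z in
    [set z | exists x y, [/\ x <> y, closest_point X z x & closest_point X z y]]].

End Euclidean.

Section GraphRealization.
Context {R : realType} {V : choiceType}.

Definition edge_point (x y : V) (c : R) : {ptws V -> R} :=
  fun v => c * (v == x)%:R + (1 - c) * (v == y)%:R.

(* Geometric realization, in barycentric coordinates, of the graph with vertex
   set S and edge relation adj; the topology of pointwise convergence is the
   usual one when S is finite. *)
Definition realization (S : set V) (adj : V -> V -> Prop) : set {ptws V -> R} :=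
  [set t | exists x y c, [/\ S x, S y, x = y \/ adj x y, 0 <= c <= 1 &
                            t = edge_point x y c]].

Definition affine_extension (S : set V) (f : V -> R) (t : {ptws V -> R}) : R :=
  \sum_(v \in S) t v * f v.

End GraphRealization.

Section PLReeb.
Context {R : realType} {m : nat}.

Definition delta_adjacent (delta : R) (x y : 'rV[R]_m) : Prop :=
  x <> y /\ enorm (x - y) <= 2 * delta.

(* Only the values of f on S are used. *)
Definition pl_reeb (S : set 'rV[R]_m) (delta : R) (f : 'rV[R]_m -> R) :
    precosheaf R :=
  @pi0_precosheaf R (realization S (delta_adjacent delta))
    (affine_extension S f \o set_val).

End PLReeb.

Section Modulus.
Context {R : realType} {m : nat}.

Definition modulus_of_continuity (X : set 'rV[R]_m) (f : 'rV[R]_m -> R)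
    (w : R -> R) : Prop :=
  [/\ w 0 = 0, forall s, 0 <= s -> 0 <= w s,
      forall s t, 0 <= s -> s <= t -> w s <= w t &
      forall x y, X x -> X y -> `|f x - f y| <= w (fine (intrinsic_dist X x y))].

Definition lipschitz1 (X : set 'rV[R]_m) (f : 'rV[R]_m -> R) : Prop :=
  forall x y, X x -> X y -> (`|f x - f y|%:E <= intrinsic_dist X x y)%E.

End Modulus.

Definition borel (R : realType) (m : nat) :=
  g_sigma_algebraType (@open 'rV[R]_m).

Section Probability.
Context {R : realType}.


Definition measure_support (m : nat) (P : set (borel R m) -> \bar R) :
    set 'rV[R]_m :=
  [set x | forall U : set 'rV[R]_m, open U -> U x -> (0 < P U)%E].

Definition standard (m : nat) (X : set 'rV[R]_m) (P : set (borel R m) -> \bar R)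
    (a b : R) : Prop :=
  forall x r, X x -> 0 < r ->
    ((Num.min (a * r `^ b) 1)%:E <= P (closed_eball x r))%E.

Definition mutually_independent d (Omega : measurableType d)
    (Pr : probability Omega R) d' (T : measurableType d') (I : finType)
    (Z : I -> {RV Pr >-> T}) : Prop :=
  forall (J : {set I}) (A : I -> set T), (forall i, measurable (A i)) ->
    Pr (\bigcap_(i in [set` J]) Z i @^-1` A i) =
    (\prod_(i in J) Pr (Z i @^-1` A i))%E.

Definition iid_sample d (Omega : measurableType d) (Pr : probability Omega R)
    d' (T : measurableType d') (P : probability T R) (n : nat)
    (Z : 'I_n -> {RV Pr >-> T}) : Prop :=
  mutually_independent Z /\
  forall i A, measurable A -> Pr (Z i @^-1` A) = P A.

(* "Pr(E) >= p" for an event E whose measurability is not presupposed: when E is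
   measurable this is (p%:E <= Pr E)%E. *)
Definition prob_ge d (Omega : measurableType d) (Pr : probability Omega R)
    (E : set Omega) (p : R) : Prop :=
  exists A, [/\ measurable A, A `<=` E & (p%:E <= Pr A)%E].

Lemma prob_geE d (Omega : measurableType d) (Pr : probability Omega R)
    (E : set Omega) (p : R) :
  measurable E -> prob_ge Pr E p <-> (p%:E <= Pr E)%E.
Proof.
move=> mE; split=> [[A [mA AE]]|pE]; last by exists E; split.
by move=> pA; apply: (le_trans pA); apply: le_measure => //; exact/mem_set.
Qed.

End Probability.

(* An infinite reach (X convex) is allowed; the value is then the limit of
   2 t asin (delta / t) as t tends to infinity. *)
Definition eta {R : realType} (tau : \bar R) (delta : R) : R :=
  if tau is t%:E then 2 * t * asin (delta / t) else 2 * delta.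

Definition alpha {R : realType} (a b : R) (n : nat) (delta : R) : R :=
  Num.min 1 (4 `^ b / (a * delta `^ b) * expR (- a * (delta / 2) `^ b * n%:R)).

(* Main.v *)
Require Import Defs.
From mathcomp Require Import all_boot all_order all_algebra.
From mathcomp Require Import generic_quotient finmap.
From mathcomp Require Import all_classical all_reals all_analysis.
From mathcomp Require Import ring lra.

Set Implicit Arguments.
Unset Strict Implicit.
Unset Printing Implicit Defensive.

Import Order.TTheory GRing.Theory Num.Theory.
Import numFieldNormedType.Exports.

Local Open Scope quotient_scope.
Local Open Scope classical_set_scope.
Local Open Scope ring_scope.

(* With probability at least [1 - alpha] every point of X is within [delta] of
   the sample: cover X by the balls of radius [delta / 2] around a maximal family
   of points at mutual distance greater than [delta / 2]; the (a, b)-standard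
   assumption bounds both the size of this family and the probability that the
   sample misses one of the balls.  For such a sample, two functors are
   interleaved as soon as points of X at Euclidean distance at most [2 delta] are
   at intrinsic distance at most [eta]: send a point of the Reeb graph to a sample
   point within [delta] of a representative, and a point of the neighbourhood
   graph to one of the vertices supporting it.

   The comparison of distances rests on Federer's inequality
   [2 t <x - c, z - c> <= |z - c| |x - c|^2] for x in X, c a closest point to z and
   [|z - c| < t <= reach X], whose proof needs no gradient flow: the distance to
   X grows at unit rate at points having a unique closest point, so its maximum
   over a ball of radius r is [r] plus its value at the centre.  It controls the
   projection on X of the midpoint of a chord; iterating on both halves yields a
   path in X that is no longer than the arc of a circle of radius t over the
   chord. *)

(** * Euclidean space *)

Section EuclideanSpace.
Context {R : realType} {m : nat}.
Implicit Types (x y z c u : 'rV[R]_m) (a r e : R) (X : set 'rV[R]_m).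

Definition dotp x y : R := \sum_(i < m) x ord0 i * y ord0 i.

Lemma dotpC x y : dotp x y = dotp y x.
Proof. by apply: eq_bigr => i _; rewrite mulrC. Qed.

Lemma dotpDl x y z : dotp (x + y) z = dotp x z + dotp y z.
Proof. by rewrite -big_split; apply: eq_bigr => i _ /=; rewrite mxE mulrDl. Qed.

Lemma dotpZl a x y : dotp (a *: x) y = a * dotp x y.
Proof. by rewrite mulr_sumr; apply: eq_bigr => i _; rewrite mxE mulrA. Qed.

Lemma dotpNl x y : dotp (- x) y = - dotp x y.
Proof. by rewrite -scaleN1r dotpZl mulN1r. Qed.

Lemma dotpDr x y z : dotp z (x + y) = dotp z x + dotp z y.
Proof. by rewrite dotpC dotpDl !(dotpC _ z). Qed.

Lemma dotpZr a x y : dotp y (a *: x) = a * dotp y x.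
Proof. by rewrite dotpC dotpZl dotpC. Qed.

Lemma dotpNr x y : dotp y (- x) = - dotp y x.
Proof. by rewrite dotpC dotpNl dotpC. Qed.

Definition dotpE := (dotpDl, dotpDr, dotpNl, dotpNr, dotpZl, dotpZr).

Lemma dotp_ge0 x : 0 <= dotp x x.
Proof. by apply: sumr_ge0 => i _; rewrite -expr2 sqr_ge0. Qed.

Lemma dotp_eq0 x : (dotp x x == 0) = (x == 0).
Proof.
apply/eqP/eqP => [/eqP|->]; last by apply: big1 => i _; rewrite mxE mulr0.
rewrite psumr_eq0 => [/allP h|i _]; last by rewrite -expr2 sqr_ge0.
apply/rowP => i; have /implyP/(_ isT) := h i (mem_index_enum i).
by rewrite mxE mulf_eq0 orbb => /eqP.
Qed.

Lemma enormE x : enorm x = Num.sqrt (dotp x x).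
Proof. by congr Num.sqrt; apply: eq_bigr => i _; rewrite expr2. Qed.

Lemma enorm_ge0 x : 0 <= enorm x.
Proof. exact: sqrtr_ge0. Qed.

Lemma sqr_enorm x : enorm x ^+ 2 = dotp x x.
Proof. by rewrite enormE sqr_sqrtr ?dotp_ge0. Qed.

Lemma enorm_eq0 x : (enorm x == 0) = (x == 0).
Proof. by rewrite enormE sqrtr_eq0 -dotp_eq0 eq_le dotp_ge0 andbT. Qed.

Lemma enorm0 : enorm (0 : 'rV[R]_m) = 0.
Proof. by apply/eqP; rewrite enorm_eq0. Qed.

Lemma enormN x : enorm (- x) = enorm x.
Proof. by rewrite !enormE dotpNl dotpNr opprK. Qed.

Lemma enormB x y : enorm (x - y) = enorm (y - x).
Proof. by rewrite -enormN opprB. Qed.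

Lemma enormZ a x : enorm (a *: x) = `|a| * enorm x.
Proof.
by rewrite !enormE dotpZl dotpZr mulrA -expr2 sqrtrM ?sqr_ge0// sqrtr_sqr.
Qed.

Lemma dotp_le_enorm x y : dotp x y <= enorm x * enorm y.
Proof.
have [/eqP y0|yn0] := boolP (y == 0).
  by rewrite y0 enorm0 mulr0 dotpC -(scale0r 0) dotpZl mul0r.
have y0 : 0 < dotp y y by rewrite lt_def dotp_eq0 yn0 dotp_ge0.
have h := dotp_ge0 (dotp y y *: x - dotp x y *: y).
have {}h : 0 <= dotp y y * (dotp x x * dotp y y - dotp x y ^+ 2).
  by move: h; rewrite !dotpE (dotpC y x); congr (_ <= _); ring.
rewrite pmulr_rge0// subr_ge0 in h.
rewrite !enormE -sqrtrM ?dotp_ge0// (le_trans (ler_norm _))//.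
by rewrite -sqrtr_sqr ler_wsqrtr.
Qed.

Lemma enormD x y : enorm (x + y) <= enorm x + enorm y.
Proof.
have h := dotp_le_enorm x y.
rewrite -(ler_pXn2r (ltn0Sn 1)) ?nnegrE ?addr_ge0 ?enorm_ge0//.
rewrite sqrrD !sqr_enorm !dotpE (dotpC y x); lra.
Qed.

Lemma enorm_triangle y x z : enorm (x - z) <= enorm (x - y) + enorm (y - z).
Proof. by rewrite (le_trans _ (enormD _ _))// addrA subrK. Qed.

Lemma enorm_dist x y : `|enorm x - enorm y| <= enorm (x - y).
Proof.
have h1 := enormD (x - y) y; have h2 := enormD (y - x) x.
rewrite subrK in h1; rewrite subrK enormB in h2.
rewrite ler_norml; lra.
Qed.

Lemma coord_le_norm x i : `|x ord0 i| <= `|x|.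
Proof.
rewrite [leRHS]/Num.Def.normr /= mx_normrE; apply/bigmax_geP; right => /=.
by exists (ord0, i).
Qed.

Lemma coord_le_enorm x i : `|x ord0 i| <= enorm x.
Proof.
rewrite -sqrtr_sqr ler_wsqrtr// (bigD1 i)//= lerDl.
by apply: sumr_ge0 => j _; exact: sqr_ge0.
Qed.

Lemma norm_le_enorm x : `|x| <= enorm x.
Proof.
rewrite [leLHS]/Num.Def.normr /= mx_normrE; apply/bigmax_leP => /=; split.
  exact: enorm_ge0.
by move=> [i j] _ /=; rewrite ord1 coord_le_enorm.
Qed.

Lemma enorm_le_norm x : enorm x <= Num.sqrt m%:R * `|x|.
Proof.
rewrite -[X in _ * X]ger0_norm// -sqrtr_sqr -sqrtrM ?ler0n// ler_wsqrtr//.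
rewrite -[m in m%:R]card_ord mulr_natl -sumr_const; apply: ler_sum => i _.
by rewrite -real_normK ?num_real// ler_pXn2r ?nnegrE// coord_le_norm.
Qed.

Lemma enorm_continuous : continuous (@enorm R m).
Proof.
move=> x; apply/(@cvgrPdist_le _ _ _ (nbhs x) (nbhs_filter x)) => e e0.
pose k := Num.sqrt m%:R + 1 : R.
have k0 : 0 < k by rewrite ltr_wpDl ?sqrtr_ge0.
near=> y.
apply: le_trans (enorm_dist _ _) _; apply: le_trans (enorm_le_norm _) _.
have h : `|x - y| <= e / k.
  near: y; have : nbhs x (ball x (e / k)) by apply: nbhsx_ballx; exact: divr_gt0.
  by apply: filterS => z; rewrite -ball_normE => /ltW.
apply: (@le_trans _ _ (k * `|x - y|)).
  by rewrite ler_wpM2r// lerDl.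
by rewrite mulrC -ler_pdivlMr.
Unshelve. all: by end_near. Qed.

Lemma edist_continuous x : continuous (fun y => enorm (y - x)).
Proof.
move=> y; apply: continuous_comp; last exact: enorm_continuous.
by apply: continuousB => //; exact: cst_continuous.
Qed.

Lemma closed_eball_closed x r : closed (closed_eball x r).
Proof.
rewrite (_ : closed_eball x r = (fun y => enorm (y - x)) @^-1` [set t | t <= r])//.
by apply: preimage_closed; [move=> y _; exact: edist_continuous|exact: closed_le].
Qed.

Lemma closed_eball_compact x r : compact (closed_eball x r).
Proof.
apply: bounded_closed_compact; last exact: closed_eball_closed.
exists (r + `|x|); split; first exact: num_real.
move=> t rt y /= yr; apply: le_trans (ltW rt).
rewrite -[y](subrK x) (le_trans (ler_normD _ _))// lerD2r.
exact: le_trans (norm_le_enorm _) yr.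
Qed.

Lemma near_enorm x r : 0 < r -> \forall y \near x, enorm (y - x) < r.
Proof.
move=> r0; have := @edist_continuous x x.
move=> /(_ [set t | t < r]); apply.
by rewrite subrr enorm0; exact: lt_nbhsl.
Qed.

End EuclideanSpace.

(** * Federer's inequality for sets of positive reach *)

Section Reach.
Context {R : realType} {m : nat}.
Implicit Types (x y z c u w : 'rV[R]_m) (a k r e t : R) (X : set 'rV[R]_m).

Lemma edist_set_le X z x : X x -> edist_set z X <= enorm (z - x).
Proof.
move=> Xx; apply: ge_inf; last by exists x.
by exists 0 => _ [y _ <-]; exact: enorm_ge0.
Qed.

Lemma exists_closest X z : compact X -> X !=set0 -> exists c, closest_point X z c.
Proof.
move=> cX [x0 Xx0].
have cont : continuous (fun y => enorm (z - y)).
  under eq_fun do rewrite enormB; exact: edist_continuous.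
have [||c Xc cmin] := @EVT_min_rV R m (fun y => enorm (z - y)) X _ cX.
- by exists x0.
- exact: continuous_subspaceT.
exists c; split; first by rewrite inE in Xc.
apply/eqP; rewrite eq_le edist_set_le ?andbT; last by rewrite inE in Xc.
apply: lb_le_inf; first by exists (enorm (z - x0)), x0.
by move=> _ [y Xy <-]; apply: cmin; rewrite inE.
Qed.

Lemma edist_set_lip X z w : compact X -> X !=set0 ->
  edist_set z X <= edist_set w X + enorm (z - w).
Proof.
move=> cX X0; have [c [Xc <-]] := exists_closest w cX X0.
rewrite addrC (le_trans (edist_set_le z Xc))//; exact: enorm_triangle.
Qed.

Lemma edist_set_continuous X : compact X -> X !=set0 ->
  continuous (edist_set^~ X).
Proof.
move=> cX X0 z; apply/(@cvgrPdist_le _ _ _ (nbhs z) (nbhs_filter z)) => e e0.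
apply: filterS (near_enorm z e0) => w /ltW wz.
have h1 := edist_set_lip z w cX X0; have h2 := edist_set_lip w z cX X0.
by rewrite enormB in h1; rewrite ler_norml; lra.
Qed.

Lemma closest_unique X z c c' : ((edist_set z X)%:E < reach X)%E ->
  closest_point X z c -> closest_point X z c' -> c = c'.
Proof.
move=> zX hc hc'; apply: contrapT => cc'; move: zX; apply/negP; rewrite -leNgt.
by apply: ereal_inf_lbound; exists z => //; exists c, c'.
Qed.

(** Continuity at [z] of the projection on [X]. The points of [X] at distance at least [e] from [c]
    form a compact set [K], strictly farther from [z] than [X] is because [c] is the only closest
    point; half of this gap is a valid [mu]. *)
Lemma closest_near X z c e : compact X ->
  ((edist_set z X)%:E < reach X)%E -> closest_point X z c -> 0 < e ->
  exists2 mu, 0 < mu & forall w c', enorm (w - z) < mu ->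
    closest_point X w c' -> enorm (c' - c) < e.
Proof.
move=> cX zX hc e0.
pose K := X `&` [set x | e <= enorm (x - c)].
have cK : compact K.
  apply: compact_closedI => //.
  apply: (@preimage_closed _ _ (fun x => enorm (x - c)) [set t | e <= t]).
    by move=> x _; exact: edist_continuous.
  exact: closed_ge.
have [K0|/set0P K0] := eqVneq K set0.
  exists 1 => // w c' _ [Xc' _]; rewrite ltNge; apply/negP => ec'.
  by have : K c' by []; rewrite K0.
have [x0 [[Xx0 ex0] zx0]] := exists_closest z cK K0.
have lt0 : edist_set z X < edist_set z K.
  rewrite -zx0 lt_neqAle edist_set_le// andbT; apply/eqP => zx0'.
  have x0c : closest_point X z x0 by [].
  move: ex0 => /=; rewrite (closest_unique zX x0c hc) subrr enorm0; lra.
exists ((edist_set z K - edist_set z X) / 2) => [|w c' wz [Xc' wc']]; first by lra.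
rewrite ltNge; apply/negP => ec'.
have Kc' : K c' by [].
have h1 := edist_set_le z Kc'.
have h2 := enorm_triangle w z c'.
have h3 := edist_set_lip w z cX (ex_intro _ c' Xc').
rewrite (enormB z w) in h2; clear zX; lra.
Qed.

(* [w] is taken on the ray issued from the closest point of [z]. *)
Lemma edist_set_ascent X z k e : compact X -> X !=set0 ->
  0 < edist_set z X -> ((edist_set z X)%:E < reach X)%E -> 0 <= k < 1 -> 0 < e ->
  exists w, [/\ 0 < enorm (w - z), enorm (w - z) < e &
    edist_set z X + k * enorm (w - z) <= edist_set w X].
Proof.
move=> cX X0 D0 zX /andP[k0 k1] e0; have [c hc] := exists_closest z cX X0.
set D := edist_set z X in D0 zX *.
(* This tolerance gives [dotp v (z - c') >= k * D] for the unit vector [v] along [z - c] and the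
   closest point [c'] to [z + h *: v], so the squared distance to [c'] is at least D^2 + 2 h k D +
   h^2 >= (D + k h)^2. *)
have [|mu mu0 hmu] := closest_near (e := (1 - k) * D) cX zX hc.
  by rewrite mulr_gt0// subr_gt0.
pose v := D^-1 *: (z - c).
have zcE : enorm (z - c) = D by case: hc.
have v1 : enorm v = 1 by rewrite enormZ zcE gtr0_norm ?invr_gt0// mulVf// gt_eqF.
have vz : dotp v (z - c) = D.
  by rewrite dotpZl -sqr_enorm zcE expr2 mulKf// gt_eqF.
clearbody v; pose h := Num.min mu e / 2.
have [hmu' he h0] : [/\ h < mu, h < e & 0 < h].
  have p0 : 0 < Num.min mu e by rewrite lt_min mu0.
  have [p1 p2] : Num.min mu e <= mu /\ Num.min mu e <= e.
    by rewrite !ge_min !lexx orbT.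
  by rewrite /h; clear zX; split; lra.
have wz : enorm (z + h *: v - z) = h.
  by rewrite addrAC subrr add0r enormZ v1 mulr1 gtr0_norm.
exists (z + h *: v); rewrite wz; split => //.
have [c' hc'] := exists_closest (z + h *: v) cX X0.
have cc' : enorm (c' - c) < (1 - k) * D by apply: hmu hc'; rewrite wz.
case: hc' => Xc' <-.
have zc' : D <= enorm (z - c') by exact: edist_set_le.
rewrite -(ler_pXn2r (ltn0Sn 1)) ?nnegrE ?enorm_ge0//; last first.
  by apply: addr_ge0; [exact: ltW|apply: mulr_ge0 => //; exact: ltW].
have h1 : dotp v (c' - c) <= (1 - k) * D.
  by rewrite (le_trans (dotp_le_enorm _ _))// v1 mul1r ltW.
have h2 : dotp v (z - c') = D - dotp v (c' - c).
  by rewrite -vz !dotpE; ring.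
have h3 : D ^+ 2 <= dotp (z - c') (z - c').
  by rewrite -sqr_enorm ler_pXn2r ?nnegrE ?enorm_ge0// ltW.
have vv : dotp v v = 1 by rewrite -sqr_enorm v1 expr1n.
have -> : enorm (z + h *: v - c') ^+ 2 =
    dotp (z - c') (z - c') + 2 * h * dotp v (z - c') + h ^+ 2.
  rewrite sqr_enorm addrAC; move: (z - c') => y.
  by rewrite !dotpE vv (dotpC y v); ring.
rewrite h2; clear zX.
have h4 : h * dotp v (c' - c) <= h * ((1 - k) * D) by rewrite ler_pM2l.
have h5 : (k * h) ^+ 2 <= h ^+ 2.
  rewrite exprMn ler_piMl ?sqr_ge0//.
  by rewrite -[1](expr1n _ 2) ler_pXn2r ?nnegrE ?ler01 // ltW.
lra.
Qed.

(* Maximise [edist_set w X - k * enorm (w - z)] with k < 1: by the ascent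
   property the maximum is reached on the boundary sphere. *)
Lemma edist_set_max_ball X z r : compact X -> X !=set0 ->
  0 < edist_set z X -> 0 < r -> ((edist_set z X + r)%:E < reach X)%E ->
  exists2 w, enorm (w - z) <= r & edist_set z X + r <= edist_set w X.
Proof.
move=> cX X0 D0 r0 Drr; set D := edist_set z X in D0 Drr *.
have cd := edist_set_continuous cX X0.
have Bz : closed_eball z r z by rewrite /closed_eball/= subrr enorm0 ltW.
have [||w1] := @EVT_max_rV R m (edist_set^~ X) (closed_eball z r) _
  (closed_eball_compact (x := z) (r := r)).
- by exists z.
- exact: continuous_subspaceT.
rewrite inE => w1B w1max; exists w1 => //; rewrite leNgt; apply/negP => w1lt.
have w1D : D <= edist_set w1 X by apply: w1max; rewrite inE.
(* Midpoint between 1 and the largest gain divided by [r]. A maximiser [w2] of [g] on the sphere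
   would gain at least [k * r], more than the maximum attained at [w1]. *)
pose k := ((edist_set w1 X - D) / r + 1) / 2.
have kr : edist_set w1 X < D + k * r.
  have -> : k * r = ((edist_set w1 X - D) + r) / 2 by rewrite /k; field; lra.
  lra.
have q0 : 0 <= (edist_set w1 X - D) / r by rewrite divr_ge0 ?subr_ge0// ltW.
have q1 : (edist_set w1 X - D) / r < 1 by rewrite ltr_pdivrMr//; lra.
have [k0 k1] : 0 <= k /\ k < 1 by rewrite /k; lra.
pose g w := edist_set w X - k * enorm (w - z).
have [||w2] := @EVT_max_rV R m g (closed_eball z r) _
  (closed_eball_compact (x := z) (r := r)).
- by exists z.
- apply: continuous_subspaceT => w.
  apply: (@continuousB _ _ _ (edist_set^~ X) (fun w => k * enorm (w - z)) w).
    exact: cd.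
  apply: (@continuousM _ _ (fun=> k) (fun w => enorm (w - z)) w).
    exact: cst_continuous.
  exact: edist_continuous.
rewrite inE /closed_eball/= => w2B w2max.
have : g z <= g w2 by apply: w2max; rewrite inE.
rewrite {1}/g subrr enorm0 mulr0 subr0 -/D => Dg.
have kn : 0 <= k * enorm (w2 - z) by rewrite mulr_ge0// enorm_ge0.
have w2le : edist_set w2 X <= edist_set w1 X by apply: w1max; rewrite inE.
have w2lt : enorm (w2 - z) < r.
  rewrite lt_neqAle w2B andbT; apply/eqP => w2r.
  move: Dg; rewrite /g w2r; lra.
(* The ascent rate [(1 + k) / 2] exceeds the penalty rate [k], so a small step inside the ball
   increases [g], a contradiction. *)
have [||||w [ww2 wr wd]] :=
    @edist_set_ascent X w2 ((1 + k) / 2) (r - enorm (w2 - z)) cX X0.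
- move: Dg; rewrite /g; lra.
- apply: le_lt_trans Drr; rewrite lee_fin; lra.
- by apply/andP; split; lra.
- by rewrite subr_gt0.
have h1 := enorm_triangle w2 w z.
have : g w <= g w2 by apply: w2max; rewrite inE /closed_eball/=; lra.
rewrite /g; nra.
Qed.

(** With [D = enorm (z - c)], [edist_set_max_ball] gives a point [w] within [t - D] of [z] and at
    distance at least [t] from [X], in particular from [c]. The triangle inequality through [z] is
    then an equality, so [w] is the point at distance [t] from [c] on the ray from [c] through
    [z]. *)
Lemma normal_ball_empty X z c x t : compact X -> closest_point X z c -> X x ->
  0 < enorm (z - c) -> enorm (z - c) <= t -> (t%:E < reach X)%E ->
  t <= enorm (c + (t / enorm (z - c)) *: (z - c) - x).
Proof.
move=> cX hc Xx D0 Dt tr.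
have zcE : enorm (z - c) = edist_set z X by case: hc.
set D := enorm (z - c) in D0 Dt zcE *.
have [->|tD] := eqVneq t D.
  by rewrite divff ?gt_eqF// scale1r (addrC c) subrK zcE edist_set_le.
have r0 : 0 < t - D by rewrite subr_gt0 lt_neqAle eq_sym tD.
have DtE : D + (t - D) = t by ring.
have X0 : X !=set0 by exists x.
have [||w wz wd] := @edist_set_max_ball X z (t - D) cX X0 _ r0.
- by rewrite -zcE.
- by rewrite -zcE DtE.
rewrite -zcE DtE in wd; clear tr.
suff -> : c + (t / D) *: (z - c) = w by rewrite (le_trans wd)// edist_set_le.
have wc : t <= enorm (w - c) by apply: (le_trans wd); apply: edist_set_le; case: hc.
have wc2 : t ^+ 2 <= enorm (w - c) ^+ 2.
  by rewrite ler_pXn2r// nnegrE ?enorm_ge0//; lra.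
have wz2 : enorm (w - z) ^+ 2 <= (t - D) ^+ 2.
  by rewrite ler_pXn2r// nnegrE ?enorm_ge0//; lra.
have E : w - c = (w - z) + (z - c) by rewrite addrA subrK.
rewrite E sqr_enorm in wc2.
rewrite !(dotpDl (w - z), dotpDr _ (z - c)) (dotpC (z - c) (w - z)) -!sqr_enorm -/D in wc2.
(* Since [w - z] has norm at most [t - D], this is the equality case of Cauchy-Schwarz. *)
have h : (t - D) * D <= dotp (w - z) (z - c) by nra.
apply/esym/eqP; rewrite -subr_eq0 -enorm_eq0 -sqrf_eq0 eq_le sqr_ge0 andbT.
have -> : w - (c + (t / D) *: (z - c)) = (w - z) - ((t - D) / D) *: (z - c).
  apply/rowP => i; rewrite !mxE; field; lra.
rewrite sqr_enorm; rewrite !sqr_enorm in wz2 wc2.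
have zc2 : dotp (z - c) (z - c) = D ^+ 2 by rewrite -sqr_enorm.
move: (w - z) (z - c) h wz2 wc2 zc2 => p1 p2 h wz2 wc2 zc2.
rewrite !dotpE (dotpC p2 p1) zc2.
set q := dotp _ _ in h *; set s := dotp _ _ in wz2 wc2 *.
have -> : s - (t - D) / D * q + (- ((t - D) / D * q) +
    - ((t - D) / D * - ((t - D) / D * D ^+ 2))) =
  s - 2 * (t - D) * (q / D) + (t - D) ^+ 2 by field; lra.
have : t - D <= q / D by rewrite ler_pdivlMr.
nra.
Qed.

(** Passage to the limit from below: [normal_ball_empty] needs a radius strictly below the reach,
    while [reach_dotp] allows [t] to equal it. *)
Lemma ler_mul_lim (D t a e : R) : D < t ->
  (forall s, D < s -> s < t -> s * a <= e) -> t * a <= e.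
Proof.
move=> Dt h; rewrite leNgt; apply/negP => lt.
have hm := h ((D + t) / 2).
have a0 : 0 < a by nra.
have ht : e / a < t by rewrite ltr_pdivrMr.
have [l|l] := leP (e / a) D.
  have := hm; rewrite -ler_pdivlMr//; lra.
have := h ((e / a + t) / 2); rewrite -ler_pdivlMr//; lra.
Qed.

(** For [s < t] the point [x] lies outside the open ball of radius [s] that touches [X] at [c] with
    centre on the ray through [z]. Expanding the squared distance from [x] to the centre, the terms
    [s ^+ 2] cancel. *)
Lemma reach_dotp X z c x t : compact X -> closest_point X z c -> X x ->
  enorm (z - c) < t -> (t%:E <= reach X)%E ->
  2 * t * dotp (x - c) (z - c) <= enorm (z - c) * enorm (x - c) ^+ 2.
Proof.
move=> cX hc Xx zct tr.
have [|D0] := eqVneq (enorm (z - c)) 0.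
  move=> h; move/eqP: (h); rewrite enorm_eq0 h mul0r => /eqP ->.
  by rewrite -(scale0r 0) dotpZr mul0r mulr0.
have {}D0 : 0 < enorm (z - c) by rewrite lt_def D0 enorm_ge0.
rewrite -mulrA mulrCA; apply: ler_mul_lim zct _ => s Ds st.
have sr : (s%:E < reach X)%E by apply: lt_le_trans tr; rewrite lte_fin.
have sb := normal_ball_empty cX hc Xx D0 (ltW Ds) sr; clear tr sr.
set D := enorm (z - c) in D0 Ds sb *.
have s0 : 0 < s by lra.
have : s ^+ 2 <= enorm (c + (s / D) *: (z - c) - x) ^+ 2.
  by rewrite ler_pXn2r// nnegrE ?enorm_ge0// ltW.
have -> : c + (s / D) *: (z - c) - x = (s / D) *: (z - c) - (x - c).
  by apply/rowP => i; rewrite !mxE; ring.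
have zc2 : dotp (z - c) (z - c) = D ^+ 2 by rewrite -sqr_enorm.
rewrite !sqr_enorm; move: (x - c) (z - c) zc2 => p1 p2 zc2.
rewrite !dotpE (dotpC p2 p1) zc2.
set q := dotp _ _; set p := dotp _ _.
have -> : s / D * (s / D * D ^+ 2) = s ^+ 2 by field; lra.
move=> h; have : s / D * q * 2 <= p by nra.
have -> : s * (2 * q) = D * (s / D * q * 2) by field; lra.
by rewrite ler_pM2l.
Qed.

End Reach.

(** * Intrinsic distance and arcs of circles *)

Section Arcsine.
Context {R : realType}.
Implicit Types (u v w x y : R).

Lemma asin_itv u : 0 <= u <= 1 -> 0 <= asin u <= pi / 2 /\ sin (asin u) = u.
Proof.
move=> /andP[u0 u1].
have u11 : -1 <= u <= 1 by apply/andP; split; lra.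
have [/andP[h1 h2] h3] := asin_def u11; split => //.
rewrite h2 andbT leNgt; apply/negP => lt0; have := pi_gt0 R => p0.
have : sin (asin u) < sin 0.
  by rewrite ltr_sin ?in_itv/= ?h1//; apply/andP; split; lra.
rewrite h3 sin0; lra.
Qed.

Lemma sinK_pos x : 0 <= x <= pi / 2 -> asin (sin x) = x.
Proof.
by move=> /andP[? ?]; have := pi_gt0 R => p0; apply: sinK; rewrite in_itv/=; lra.
Qed.

Lemma ler_asin u v : 0 <= u -> u <= v -> v <= 1 -> asin u <= asin v.
Proof.
move=> u0 uv v1.
have [|/andP[h1 h2] h3] := @asin_itv u; first by apply/andP; split; lra.
have [|/andP[h4 h5] h6] := @asin_itv v; first by apply/andP; split; lra.
have p0 := pi_gt0 R.
rewrite leNgt; apply/negP => lt.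
have : sin (asin v) < sin (asin u) by rewrite ltr_sin ?in_itv//=; lra.
rewrite h3 h6; lra.
Qed.

Lemma asin_lt_pihalf u : 0 <= u < 1 -> asin u < pi / 2.
Proof. by move=> /andP[? ?]; apply: asin_ltpi2; apply/andP; split; lra. Qed.

Lemma sinB_cos x y : x < y ->
  exists2 c, c \in `]x, y[ & sin y - sin x = cos c * (y - x).
Proof.
move=> xy; apply: MVT => //.
by apply: continuous_subspaceT; exact: continuous_sin.
Qed.

Lemma ler_cos_pos x y : 0 <= x -> x <= y -> y <= pi -> cos y <= cos x.
Proof.
move=> x0 xy yp; rewrite leNgt; apply/negP; rewrite ltr_cos ?in_itv/=; lra.
Qed.

Lemma le_asin u : 0 <= u <= 1 -> u <= asin u.
Proof.
move=> /asin_itv[/andP[]]; set x := asin u; rewrite le_eqVlt => /predU1P[<- _ <-|x0 _ <-].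
  by rewrite sin0.
have [c _] := sinB_cos x0; rewrite sin0 !subr0 => ->.
by rewrite ler_piMl ?cos_le1// ltW.
Qed.

(** With [x = asin u] this is [x * cos x <= sin x]: by the mean value theorem [sin x = cos c * x]
    for some [c] below [x], and [cos x <= cos c]. It controls arcs of large radius when the reach is
    infinite. *)
Lemma asin_mul_sqrt_le u : 0 <= u <= 1 -> asin u * Num.sqrt (1 - u ^+ 2) <= u.
Proof.
move=> u01; have [/andP[]] := asin_itv u01.
have <- : cos (asin u) = Num.sqrt (1 - u ^+ 2).
  by apply: cos_asin; move: u01 => /andP[? ?]; apply/andP; split; lra.
set x := asin u; have p0 := pi_gt0 R.
rewrite le_eqVlt => /predU1P[<- _ <-|x0 xp su].
  by rewrite mul0r sin0.
have [c] := sinB_cos x0; rewrite in_itv/= sin0 !subr0 su => /andP[c0 cx] ->.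
rewrite mulrC ler_pM2r//; apply: ler_cos_pos; lra.
Qed.

(** [cos (pi / 6)] is the sine of the complementary angle, twice [pi / 6], hence equals
    [2 * sin (pi / 6) * cos (pi / 6)]; the positive cosine cancels. *)
Lemma sin_pi6 : sin (pi / 6) = 2^-1 :> R.
Proof.
have p0 := pi_gt0 R.
have c0 : 0 < cos (pi / 6) :> R by apply: cos_gt0_pihalf; apply/andP; split; lra.
have := sinDpihalf (- (pi / 6 : R)).
have -> : - (pi / 6) + pi / 2 = (pi / 6) *+ 2 :> R by rewrite [RHS]mulr2n; lra.
rewrite cosN sin_mulr2n [LHS]mulr2n => h.
have : cos (pi / 6 : R) * (2 * sin (pi / 6) - 1) = 0 by nra.
by move/eqP; rewrite mulf_eq0 gt_eqF//= => /eqP; lra.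
Qed.

(* Concavity of [sin] on [0, pi/6]. *)
Lemma asin_le_pi3 u : 0 <= u <= 2^-1 -> asin u <= pi / 3 * u.
Proof.
move=> /andP[u0 u2]; have p0 := pi_gt0 R.
have [|/andP[x0 xp] su] := @asin_itv u; first by apply/andP; split; lra.
have xp6 : asin u <= pi / 6.
  rewrite -[leRHS]sinK_pos; last by apply/andP; split; lra.
  rewrite sin_pi6; apply: ler_asin; lra.
move: x0 xp6; set x := asin u in su xp *.
rewrite le_eqVlt => /predU1P[<- _|x0]; first by rewrite mulr_ge0// divr_ge0// ltW.
rewrite le_eqVlt => /predU1P[xE|x6].
  by rewrite -su xE sin_pi6; lra.
have [c1] := sinB_cos x0; rewrite in_itv/= sin0 !subr0 su => /andP[? ?] e1.
have [c2] := sinB_cos x6; rewrite in_itv/= sin_pi6 su => /andP[? ?] e2.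
have cc : cos c2 <= cos c1 by apply: ler_cos_pos; lra.
have h : x * (2^-1 - u) <= (pi / 6 - x) * u.
  rewrite e2 [in leRHS]e1.
  have -> : x * (cos c2 * (pi / 6 - x)) = x * (pi / 6 - x) * cos c2 by ring.
  have -> : (pi / 6 - x) * (cos c1 * x) = x * (pi / 6 - x) * cos c1 by ring.
  by apply: ler_wpM2l => //; apply: mulr_ge0; lra.
lra.
Qed.

(** At [2^-1] the lower bound [le_asin] meets the upper bound [asin_le_pi3]. It serves the case of
    infinite reach, where [eta] is [2 * delta]. *)
Lemma pi_ge3 : 3 <= pi :> R.
Proof.
have := @le_asin 2^-1; have := @asin_le_pi3 2^-1.
have e : 0 <= (2^-1 : R) <= 2^-1 by apply/andP; split; lra.
move=> /(_ e) h1 h2; have : (2^-1 : R) <= asin 2^-1 by apply: h2; apply/andP; split; lra.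
lra.
Qed.

(* cos (x + y) cos (x - y) = 1 - sin^2 x - sin^2 y *)
Lemma asinD_le u v w : 0 <= u < 1 -> 0 <= v < 1 -> 0 <= w < 1 ->
  u ^+ 2 + v ^+ 2 <= 1 - Num.sqrt (1 - w ^+ 2) ->
  asin u + asin v <= asin w.
Proof.
move=> u01 v01 w01; have p0 := pi_gt0 R.
have xp := asin_lt_pihalf u01; have yp := asin_lt_pihalf v01.
have zp := asin_lt_pihalf w01.
have <- : cos (asin w) = Num.sqrt (1 - w ^+ 2).
  by apply: cos_asin; move: w01 => /andP[? ?]; apply/andP; split; lra.
have [|/andP[x0 _] su] := @asin_itv u; first by move: u01 => /andP[-> /ltW].
have [|/andP[y0 _] sv] := @asin_itv v; first by move: v01 => /andP[-> /ltW].
have [|/andP[z0 _] sw] := @asin_itv w; first by move: w01 => /andP[-> /ltW].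
move: (asin u) (asin v) (asin w) su sv sw xp yp zp x0 y0 z0 => x y z.
move=> <- <- _ xp yp zp x0 y0 z0 h.
have E : cos (x + y) * cos (x - y) = 1 - (sin x ^+ 2 + sin y ^+ 2).
  have := cos2sin2 x; have := cos2sin2 y.
  rewrite cosD cosB; set a := cos x; set b := cos y => e1 e2.
  have -> : (a * b - sin x * sin y) * (a * b + sin x * sin y) =
    a ^+ 2 * b ^+ 2 - sin x ^+ 2 * sin y ^+ 2 by ring.
  by rewrite e1 e2; ring.
have cz : 0 < cos z by apply: cos_gt0_pihalf; apply/andP; split; lra.
have cd : 0 < cos (x - y) by apply: cos_gt0_pihalf; apply/andP; split; lra.
have cs : 0 < cos (x + y) by rewrite -(pmulr_lgt0 _ cd) E; lra.
have c1 := cos_le1 (x - y).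
(* As [cos (x - y)] is positive and at most 1, multiplying by it can only decrease the positive
   number [cos (x + y)]. *)
have h2 : cos z <= cos (x + y).
  apply: (@le_trans _ _ (cos (x + y) * cos (x - y))); first by rewrite E; lra.
  by rewrite ler_piMr// ltW.
rewrite leNgt; apply/negP => lt; move: h2; apply/negP; rewrite -ltNge.
by rewrite ltr_cos ?in_itv//=; lra.
Qed.

End Arcsine.

(** * Projection of the midpoint of a chord on a set of positive reach *)

Section Midpoint.
Context {R : realType} {m : nat}.
Implicit Types (x y z c : 'rV[R]_m) (t L : R) (X : set 'rV[R]_m).

(* Length of the arc of a circle of radius [t] above a chord [x, y]. *)
Definition arc t x y : R := 2 * t * asin (enorm (x - y) / (2 * t)).

Lemma chord_itv t x y : enorm (x - y) < 2 * t -> 0 <= enorm (x - y) / (2 * t) < 1.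
Proof.
move=> xyt; have t0 : 0 < 2 * t by apply: le_lt_trans xyt; exact: enorm_ge0.
by rewrite divr_ge0 ?enorm_ge0 ?ltW//= ltr_pdivrMr// mul1r.
Qed.

Lemma enorm_le_arc t x y : enorm (x - y) < 2 * t -> enorm (x - y) <= arc t x y.
Proof.
move=> xyt; have t0 : 0 < 2 * t by apply: le_lt_trans xyt; exact: enorm_ge0.
rewrite -[leLHS](divfK (lt0r_neq0 t0)) mulrC ler_pM2l//.
by apply: le_asin; have /andP[-> /ltW] := chord_itv xyt.
Qed.

(** Take for [c] a closest point to the midpoint of the chord. Federer's inequality at [x] and [y]
    bounds its distance [s] to the midpoint by the sagitta of the arc of radius [t]; by the
    parallelogram law the two new chords are then short enough for [asinD_le]. *)
Lemma exists_midpoint X t L x y : compact X -> 0 < t -> (t%:E <= reach X)%E ->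
  L < 2 * t -> X x -> X y -> enorm (x - y) <= L ->
  exists c, [/\ X c, arc t x c + arc t c y <= arc t x y,
    enorm (x - c) <= 2 * t / (4 * t - L) * enorm (x - y) &
    enorm (c - y) <= 2 * t / (4 * t - L) * enorm (x - y)].
Proof.
move=> cX t0 tr Lt Xx Xy xyL; pose mid := 2^-1 *: (x + y).
pose h := 2^-1 *: (x - y).
have [c hc] := exists_closest mid cX (ex_intro _ x Xx).
have xm : x - mid = h by apply/rowP => i; rewrite !mxE; lra.
have ym : y - mid = - h by apply/rowP => i; rewrite !mxE; lra.
set l := enorm (x - y) in xyL *; have l0 : 0 <= l by exact: enorm_ge0.
have nh : enorm h = l / 2 by rewrite enormZ gtr0_norm ?invr_gt0// mulrC.
clearbody h; set s := enorm (mid - c).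
have s0 : 0 <= s by exact: enorm_ge0.
have sl : s <= l / 2.
  have [_] := hc; rewrite -/s => ->; rewrite -nh -xm enormB; exact: edist_set_le.
have st : s < t by lra.
have hx := reach_dotp cX hc Xx st tr; have hy := reach_dotp cX hc Xy st tr.
clear tr; set A := enorm (x - c) ^+ 2 + enorm (y - c) ^+ 2.
have xcE : x - c = (mid - c) + h by rewrite -xm; apply/rowP => i; rewrite !mxE; lra.
have ycE : y - c = (mid - c) - h by rewrite -ym; apply/rowP => i; rewrite !mxE; lra.
have AE : A = 2 * s ^+ 2 + l ^+ 2 / 2.
  have -> : l ^+ 2 / 2 = 2 * enorm h ^+ 2 by rewrite nh; field.
  by rewrite /A xcE ycE !sqr_enorm; move: (mid - c) => v; rewrite !dotpE (dotpC h v); ring.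
have dE : dotp (x - c) (mid - c) + dotp (y - c) (mid - c) = 2 * s ^+ 2.
  by rewrite xcE ycE /s sqr_enorm; move: (mid - c) => v; rewrite !dotpE; ring.
(* Sum of Federer's inequalities for [x] and [y], divided by [s]. *)
have sA : 4 * t * s <= A.
  have [->|sn0] := eqVneq s 0; first by rewrite mulr0 addr_ge0// sqr_ge0.
  have {sn0}sp : 0 < s by rewrite lt_def sn0.
  have : 2 * t * (2 * s ^+ 2) <= s * A.
    by rewrite -dE !mulrDr; exact: lerD.
  have -> : 2 * t * (2 * s ^+ 2) = s * (4 * t * s) by ring.
  by rewrite ler_pM2l.
have sq : s * (4 * t - l) <= l ^+ 2 / 2 by nra.
have tl : 0 < 4 * t - l by lra.
have tL : 0 < 4 * t - L by lra.
(* By [sq], [l / 2 + s] is at most [2 * t * l / (4 * t - l)]. Replacing [l] by its bound [L] in the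
   denominator gives a factor that stays the same when chords are halved again. *)
have bound z : enorm (z - mid) = l / 2 ->
    enorm (z - c) <= 2 * t / (4 * t - L) * l.
  move=> zm; rewrite mulrAC ler_pdivlMr//.
  have h1 := enorm_triangle mid z c; rewrite zm -/s in h1.
  apply: (@le_trans _ _ ((l / 2 + s) * (4 * t - l))); last by nra.
  apply: (@le_trans _ _ ((l / 2 + s) * (4 * t - L))).
    by rewrite ler_wpM2r// ltW.
  by rewrite ler_wpM2l//; lra.
have bx : enorm (x - c) <= 2 * t / (4 * t - L) * l by apply: bound; rewrite xm.
have by_ : enorm (c - y) <= 2 * t / (4 * t - L) * l.
  by rewrite enormB; apply: bound; rewrite ym enormN.
have q1 : 2 * t / (4 * t - L) * l <= l by rewrite ler_piMl// ler_pdivrMr//; lra.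
exists c; split => //; first by case: hc.
rewrite /arc -mulrDr ler_pM2l; last by lra.
have l2t : enorm (x - y) < 2 * t by exact: le_lt_trans Lt.
have x2t : enorm (x - c) < 2 * t by rewrite (le_lt_trans bx)// (le_lt_trans q1).
have y2t : enorm (c - y) < 2 * t by rewrite (le_lt_trans by_)// (le_lt_trans q1).
apply: asinD_le; [exact: chord_itv..|].
set k := Num.sqrt (1 - _).
have k0 : 0 <= k by exact: sqrtr_ge0.
have lE : l ^+ 2 = 4 * t ^+ 2 * (1 - k ^+ 2).
  rewrite [k ^+ 2]sqr_sqrtr; first by rewrite -/l; field; lra.
  have /andP[w0 w1] := chord_itv l2t.
  by rewrite subr_ge0 exprn_ile1 // ltW.
have k1 : k <= 1.
  rewrite leNgt; apply/negP => k1; have := sqr_ge0 l; rewrite lE.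
  have : 0 < t ^+ 2 * ((k - 1) * (k + 1)) by rewrite !mulr_gt0//; lra.
  lra.
(* [sA] amounts to [(t * k) ^+ 2 <= (t - s) ^+ 2], and [s < t] selects the smaller root. The
   right-hand side is the sagitta of the arc. *)
have sk : s <= t * (1 - k).
  rewrite leNgt; apply/negP => lt.
  have : (t - s) ^+ 2 < (t * k) ^+ 2 by rewrite ltr_pXn2r ?nnegrE//; nra.
  nra.
have -> : (enorm (x - c) / (2 * t)) ^+ 2 + (enorm (c - y) / (2 * t)) ^+ 2 =
    A / (4 * t ^+ 2) by rewrite /A (enormB c y); field; lra.
rewrite ler_pdivrMr; last by nra.
rewrite AE lE.
have : s ^+ 2 <= (t * (1 - k)) ^+ 2 by rewrite ler_pXn2r ?nnegrE//; nra.
lra.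
Qed.

End Midpoint.

(** * Limit paths of iterated midpoints *)

Section DyadicPath.
Context {R : realType} {m : nat}.
Implicit Types (x y c : 'rV[R]_m) (X : set 'rV[R]_m) (q s t e C : R).

Lemma geometric_small C q e : 0 <= q < 1 -> 0 < e -> exists k : nat, C * q ^+ k < e.
Proof.
move=> /andP[q0 q1] e0; have q11 : `|q| < 1 by rewrite ger0_norm.
have /cvgrPdist_lt/(_ e e0) := @cvg_geometric R C q q11.
move=> [k _ /(_ k (leqnn k))] /=; rewrite sub0r normrN => h.
by exists k; exact: le_lt_trans (ler_norm _) h.
Qed.

Lemma le_geometric C q e u : 0 <= q < 1 ->
  (forall k : nat, u <= e + C * q ^+ k) -> u <= e.
Proof.
move=> q01 h; rewrite leNgt; apply/negP => eu.
have [|k hk] := @geometric_small C q (u - e) q01; first by rewrite subr_gt0.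
have := h k; lra.
Qed.

(** Summing the geometric series, the closed ball of radius [K * q ^+ k] around [u k] contains a
    tail of the sequence. A cluster point, which exists by compactness of the ball for [k = 0],
    therefore lies in all of them. *)
Lemma geometric_limit (u : nat -> 'rV[R]_m) C q : 0 <= q < 1 -> 0 <= C ->
  (forall k, enorm (u k.+1 - u k) <= C * q ^+ k) ->
  exists l, forall k, enorm (l - u k) <= C / (1 - q) * q ^+ k.
Proof.
move=> /andP[q0 q1] C0 hu; have q1' : 0 < 1 - q by rewrite subr_gt0.
set K := C / (1 - q); have K0 : 0 <= K by rewrite divr_ge0// ltW.
have CK : C = K * (1 - q) by rewrite /K; field; lra.
have step k n : enorm (u (k + n)%N - u k) <= K * (q ^+ k - q ^+ (k + n)).
  elim: n => [|n IH]; first by rewrite addn0 !subrr enorm0 mulr0.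
  rewrite addnS (le_trans (enorm_triangle (u (k + n)%N) _ _))//.
  apply: le_trans (lerD (hu _) IH) _.
  by rewrite CK exprS le_eqVlt; apply/orP; left; apply/eqP; ring.
have tail k n : (k <= n)%N -> enorm (u n - u k) <= K * q ^+ k.
  move=> /subnKC <-; rewrite (le_trans (step _ _))// ler_wpM2l//.
  by rewrite gerBl exprn_ge0.
have cl k : \forall n \near \oo, closed_eball (u k) (K * q ^+ k) (u n).
  by exists k => // n /= kn; exact: tail.
have [|l [_ hl]] := @closed_eball_compact R m (u 0%N) (K * q ^+ 0) (u @ \oo) _.
  exact: cl.
exists l => k; have := @closed_eball_closed R m (u k) (K * q ^+ k) l; apply.
by move=> B lB; apply: hl lB; exact: cl.
Qed.

Section Construction.
Variables (X : set 'rV[R]_m) (mid : 'rV[R]_m -> 'rV[R]_m -> 'rV[R]_m).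
Variables (cost : 'rV[R]_m -> 'rV[R]_m -> R) (L q : R).
Hypothesis cX : compact X.
Hypothesis q01 : 0 <= q < 1.

Definition close_in x y := [/\ X x, X y & enorm (x - y) <= L].

Hypothesis le_cost : forall x y, close_in x y -> enorm (x - y) <= cost x y.
Hypothesis midX : forall x y, close_in x y -> X (mid x y).
Hypothesis mid_cost : forall x y, close_in x y ->
  cost x (mid x y) + cost (mid x y) y <= cost x y.
Hypothesis midl : forall x y, close_in x y ->
  enorm (x - mid x y) <= q * enorm (x - y).
Hypothesis midr : forall x y, close_in x y ->
  enorm (mid x y - y) <= q * enorm (x - y).

Lemma mid_close x y : close_in x y ->
  close_in x (mid x y) /\ close_in (mid x y) y.
Proof.
move=> xy; have [Xx Xy xyL] := xy; have /andP[q0 q1] := q01.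
have qL : q * enorm (x - y) <= L.
  by apply: le_trans xyL; rewrite ler_piMl ?enorm_ge0// ltW.
split; split => //; try exact: midX.
  exact: le_trans (midl xy) qL.
exact: le_trans (midr xy) qL.
Qed.

Fixpoint approx k x y t : 'rV[R]_m :=
  if k is k'.+1 then
    if t <= 2^-1 then approx k' x (mid x y) (2 * t)
    else approx k' (mid x y) y (2 * t - 1)
  else x + t *: (y - x).

(** A real function whose increments dominate those of [approx], and whose total increment is at
    most [cost x y]; it bounds all polygonal sums of the approximation at once. *)
Fixpoint arclen k x y t : R :=
  if k is k'.+1 then
    if t <= 2^-1 then arclen k' x (mid x y) (2 * t)
    else cost x (mid x y) + arclen k' (mid x y) y (2 * t - 1)
  else t * cost x y.

Let half_ge0 : 0 <= (2^-1 : R).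
Proof. by rewrite invr_ge0. Qed.

Let half_lt1 : (1 <= (2^-1 : R)) = false.
Proof. by apply/negbTE; rewrite -ltNge invf_lt1// ltr1n. Qed.

Let dbl1 : 2 * 1 - 1 = 1 :> R.
Proof. by lra. Qed.

Lemma approx0 k x y : approx k x y 0 = x.
Proof.
elim: k x y => [|k IH] x y /=; first by rewrite scale0r addr0.
by rewrite half_ge0 mulr0 IH.
Qed.

Lemma approx1 k x y : approx k x y 1 = y.
Proof.
elim: k x y => [|k IH] x y /=; first by rewrite scale1r addrC subrK.
by rewrite half_lt1 dbl1 IH.
Qed.

Lemma arclen0 k x y : arclen k x y 0 = 0.
Proof.
elim: k x y => [|k IH] x y /=; first by rewrite mul0r.
by rewrite half_ge0 mulr0 IH.
Qed.

Lemma arclen1 k x y : close_in x y -> arclen k x y 1 <= cost x y.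
Proof.
elim: k x y => [|k IH] x y xy /=; first by rewrite mul1r.
rewrite half_lt1 dbl1; apply: le_trans (mid_cost xy); rewrite lerD2l.
by apply: IH; have [] := mid_close xy.
Qed.

Lemma approx_le_arclen k x y s t : close_in x y -> 0 <= s -> s <= t -> t <= 1 ->
  enorm (approx k x y t - approx k x y s) <= arclen k x y t - arclen k x y s.
Proof.
elim: k x y s t => [|k IH] x y s t xy s0 st t1 /=.
  have -> : x + t *: (y - x) - (x + s *: (y - x)) = (t - s) *: (y - x).
    by apply/rowP => i; rewrite !mxE; ring.
  rewrite enormZ ger0_norm ?subr_ge0// -mulrBl ler_wpM2l ?subr_ge0//.
  by rewrite enormB; exact: le_cost.
have [xc cy] := mid_close xy.
case: (leP t 2^-1) => [th|ht]; case: (leP s 2^-1) => [sh|hs]; try lra.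
- apply: IH => //; lra.
(* The midpoint separates [s] and [t]. At the junction [arclen] can only jump upwards, since
   [arclen1] bounds the left half by the offset [cost x (mid x y)] of the right half. *)
- rewrite (le_trans (enorm_triangle (mid x y) _ _))//.
  have h1 := IH _ _ 0 (2 * t - 1) cy (lexx _).
  have h2 := IH _ _ (2 * s) 1 xc.
  rewrite approx0 arclen0 subr0 in h1; rewrite approx1 in h2.
  have {}h1 : enorm (approx k (mid x y) y (2 * t - 1) - mid x y)
    <= arclen k (mid x y) y (2 * t - 1) by apply: h1; lra.
  have {}h2 : enorm (mid x y - approx k x (mid x y) (2 * s)) <=
    arclen k x (mid x y) 1 - arclen k x (mid x y) (2 * s) by apply: h2; lra.
  have h3 := arclen1 k xc; lra.
- rewrite opprD addrACA subrr add0r; apply: IH => //; lra.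
Qed.

(** Each of the [2 ^+ k] segments has length at most [L]. The constant grows with [k], but
    continuity of the limit uses it at one fixed [k] at a time. *)
Lemma approx_lipschitz k x y s t : close_in x y ->
  enorm (approx k x y t - approx k x y s) <= 2 ^+ k * L * `|t - s|.
Proof.
wlog st : s t / s <= t.
  move=> h xy; have [st|/ltW ts] := leP s t; first exact: h.
  by rewrite enormB distrC; exact: h.
rewrite ger0_norm ?subr_ge0//.
elim: k x y s t st => [|k IH] x y s t st xy /=.
  have -> : x + t *: (y - x) - (x + s *: (y - x)) = (t - s) *: (y - x).
    by apply/rowP => i; rewrite !mxE; ring.
  rewrite expr0 mul1r enormZ ger0_norm ?subr_ge0// mulrC.
  by apply: ler_wpM2r; [rewrite subr_ge0|case: xy => _ _; rewrite enormB].
have [xc cy] := mid_close xy.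
have E : 2 ^+ k.+1 * L * (t - s) = 2 ^+ k * L * (2 * t - 2 * s).
  by rewrite exprS; ring.
rewrite {}E.
case: (leP t 2^-1) => [th|ht]; case: (leP s 2^-1) => [sh|hs]; try lra.
- apply: IH => //; lra.
- rewrite (le_trans (enorm_triangle (mid x y) _ _))//.
  have h1 := IH _ _ 0 (2 * t - 1) _ cy; have h2 := IH _ _ (2 * s) 1 _ xc.
  rewrite approx0 in h1; rewrite approx1 in h2.
  have -> : 2 ^+ k * L * (2 * t - 2 * s) =
    2 ^+ k * L * (2 * t - 1 - 0) + 2 ^+ k * L * (1 - 2 * s) by ring.
  by apply: lerD; [apply: h1; lra|apply: h2; lra].
- have -> : 2 * t - 2 * s = (2 * t - 1) - (2 * s - 1) by ring.
  apply: IH => //; lra.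
Qed.

Lemma approx_near k x y t : close_in x y -> 0 <= t <= 1 ->
  exists2 z, X z & enorm (approx k x y t - z) <= enorm (x - y) * q ^+ k.
Proof.
have /andP[q0 q1] := q01.
elim: k x y t => [|k IH] x y t xy /andP[t0 t1] /=.
  have [Xx _ _] := xy; exists x => //.
  rewrite addrAC subrr add0r enormZ ger0_norm// expr0 mulr1 enormB.
  by rewrite ler_piMl ?enorm_ge0.
have [xc cy] := mid_close xy.
case: (leP t 2^-1) => th.
  have [|z Xz hz] := IH x (mid x y) (2 * t) xc; first by apply/andP; split; lra.
  exists z => //; apply: le_trans hz _; rewrite exprS mulrA.
  by apply: ler_wpM2r; [exact: exprn_ge0|rewrite mulrC; exact: midl].
have [|z Xz hz] := IH (mid x y) y (2 * t - 1) cy; first by apply/andP; split; lra.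
exists z => //; apply: le_trans hz _; rewrite exprS mulrA.
by apply: ler_wpM2r; [exact: exprn_ge0|rewrite mulrC; exact: midr].
Qed.

(** Passing to level [k.+1] replaces each segment of level [k] by its two half chords, which moves
    points by a bounded multiple of the segment; the segments shrink like [q ^+ k]. *)
Lemma approx_cauchy k x y t : close_in x y -> 0 <= t <= 1 ->
  enorm (approx k.+1 x y t - approx k x y t) <= 3 * enorm (x - y) * q ^+ k.
Proof.
have /andP[q0 q1] := q01.
elim: k x y t => [|k IH] x y t xy /andP[t0 t1].
  rewrite /= expr0 mulr1; have xy0 := enorm_ge0 (x - y).
  have bl : enorm (x - mid x y) <= enorm (x - y).
    by rewrite (le_trans (midl xy))// ler_piMl// ltW.
  have br : enorm (mid x y - y) <= enorm (x - y).
    by rewrite (le_trans (midr xy))// ler_piMl// ltW.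
  have b2 (a b : R) (u v : 'rV[R]_m) : 0 <= a <= 1 -> 0 <= b <= 1 ->
      enorm u <= enorm (x - y) -> enorm v <= enorm (x - y) ->
      enorm (a *: u + b *: v) <= 3 * enorm (x - y).
    move=> /andP[a0 a1] /andP[b0 b1] hu hv; rewrite (le_trans (enormD _ _))// !enormZ !ger0_norm//.
    have h1 : a * enorm u <= enorm u by rewrite ler_piMl// enorm_ge0.
    have h2 : b * enorm v <= enorm v by rewrite ler_piMl// enorm_ge0.
    lra.
  case: (leP t 2^-1) => th.
    have -> : x + (2 * t) *: (mid x y - x) - (x + t *: (y - x)) =
      (2 * t) *: (mid x y - x) + t *: (x - y).
      by apply/rowP => i; rewrite !mxE; ring.
    by apply: b2; rewrite // 1?enormB//; apply/andP; split; lra.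
  have -> : mid x y + (2 * t - 1) *: (y - mid x y) - (x + t *: (y - x)) =
    (2 - 2 * t) *: (mid x y - y) + (1 - t) *: (y - x).
    by apply/rowP => i; rewrite !mxE; ring.
  apply: b2 => //; try by rewrite enormB.
  - by apply/andP; split; lra.
  - by apply/andP; split; lra.
have [xc cy] := mid_close xy.
rewrite [approx k.+2 x y t]/= -/(approx k.+1) [approx k.+1 x y t]/=.
case: (leP t 2^-1) => th.
  apply: le_trans (IH x (mid x y) (2 * t) xc _) _.
    by apply/andP; split; lra.
  rewrite exprS mulrA; apply: ler_wpM2r; first exact: exprn_ge0.
  by rewrite -mulrA; apply: ler_wpM2l => //; rewrite mulrC; exact: midl.
apply: le_trans (IH (mid x y) y (2 * t - 1) cy _) _.
  by apply/andP; split; lra.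
rewrite exprS mulrA; apply: ler_wpM2r; first exact: exprn_ge0.
by rewrite -mulrA; apply: ler_wpM2l => //; rewrite mulrC; exact: midr.
Qed.

(** The increments of [l] telescope over the partition, while the error [C] is paid once per
    segment. For a fixed partition this error is later made to vanish. *)
Lemma polygonal_sum_le (p : R -> 'rV[R]_m) (l : R -> R) C (r : seq R) :
  itv_partition 0 1 r ->
  (forall s t, 0 <= s -> s <= t -> t <= 1 -> enorm (p t - p s) <= C + (l t - l s)) ->
  polygonal_sum p r <= C *+ size r + (l 1 - l 0).
Proof.
move=> hr hp; pose T := nth 1 (0 :: r).
have sum_le : polygonal_sum p r <=
    \sum_(0 <= k < size r) (C + (l (T k.+1) - l (T k))).
  rewrite /polygonal_sum !big_nat; apply: ler_sum => k /andP[_ kr]; apply: hp.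
  - by apply: itv_partition_nth_ge hr; rewrite ltnS ltnW.
  - exact: (@nondecreasing_fun_itv_partition _ _ 0 1 id r).
  - exact: (@itv_partition_nth_le _ _ 0 1 r k.+1).
apply: le_trans sum_le _; rewrite big_split/= sumr_const_nat subn0 lerD2l.
by rewrite (telescope_sumr (l \o T))//= /T (itv_partition_nth_size _ hr).
Qed.

(** The approximations converge uformly on [0, 1] at a geometric rate. The limit lies in [X] by
    [approx_near] and compactness, and each fixed polygonal sum is at most [cost x y] plus an error
    that tends to 0 with the level. *)
Lemma exists_dyadic_path x y : close_in x y ->
  exists2 p, is_path_in X p x y & (path_length p <= (cost x y)%:E)%E.
Proof.
move=> xy; have [Xx Xy xyL] := xy; have /andP[q0 q1] := q01.
have n0 := enorm_ge0 (x - y).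
pose K := 3 * enorm (x - y) / (1 - q).
have K0 : 0 <= K by rewrite divr_ge0 ?mulr_ge0// subr_ge0 ltW.
pose lim_at t : set 'rV[R]_m :=
  [set l | forall k, enorm (l - approx k x y t) <= K * q ^+ k].
pose p t := xget x (lim_at t).
have pP t k : 0 <= t -> t <= 1 -> enorm (p t - approx k x y t) <= K * q ^+ k.
  move=> t0 t1; have : lim_at t (p t).
    apply: xgetPex; apply: (geometric_limit (u := fun k => approx k x y t)) => //.
      by rewrite mulr_ge0.
    by move=> j; apply: approx_cauchy => //; rewrite t0 t1.
  exact.
have pX t : 0 <= t -> t <= 1 -> X (p t).
  move=> t0 t1; have [c [Xc pc]] := exists_closest (p t) cX (ex_intro _ x Xx).
  suff : enorm (p t - c) <= 0.
    move=> h; have : enorm (p t - c) == 0 by rewrite eq_le h enorm_ge0.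
    by rewrite enorm_eq0 subr_eq0 => /eqP ->.
  apply: (@le_geometric (K + enorm (x - y)) q 0) => // k.
  have [|z Xz hz] := @approx_near k x y t xy; first by rewrite t0 t1.
  rewrite pc add0r (le_trans (edist_set_le _ Xz))//.
  rewrite (le_trans (enorm_triangle (approx k x y t) _ _))// mulrDl.
  by apply: lerD => //; exact: pP.
have pE t u : lim_at t u -> 0 <= t -> t <= 1 -> p t = u.
  move=> hu t0 t1; apply/eqP; rewrite -subr_eq0 -enorm_eq0 eq_le enorm_ge0 andbT.
  apply: (@le_geometric (K + K) q 0) => // k; rewrite add0r mulrDl.
  rewrite (le_trans (enorm_triangle (approx k x y t) _ _))//.
  by apply: lerD; [exact: pP|rewrite enormB; exact: hu].
have near_approx s t k : 0 <= s -> s <= 1 -> 0 <= t -> t <= 1 ->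
    enorm (p t - p s) <= 2 * K * q ^+ k + enorm (approx k x y t - approx k x y s).
  move=> s0 s1 t0 t1; have h1 := pP t k t0 t1; have h2 := pP s k s0 s1.
  have h3 := enorm_triangle (approx k x y t) (p t) (p s).
  have h4 := enorm_triangle (approx k x y s) (approx k x y t) (p s).
  by rewrite (enormB (approx k x y s) (p s)) in h4; lra.
exists p; first split.
- apply/subspace_continuousP => s /=; rewrite in_itv/= => /andP[s0 s1].
  apply/(@cvgrPdist_le _ _ _ (within _ (nbhs s)) _) => e e0.
  have e2 : 0 < e / 2 by rewrite divr_gt0.
  (* First a level [k] at which both values of [p] are close to those of [approx k]; only then the
     Lipschitz constant of this level determines the neighbourhood of [s]. *)
  have [k hk] := geometric_small (2 * K) q01 e2.
  have M0 : 0 < 2 ^+ k * L + 1.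
    by rewrite ltr_wpDl// mulr_ge0// ?exprn_ge0//; exact: le_trans xyL.
  rewrite near_withinE; near=> t; rewrite /= in_itv/= => /andP[t0 t1].
  apply: le_trans (norm_le_enorm _) _.
  rewrite (le_trans (near_approx t s k t0 t1 s0 s1))//.
  have h1 := @approx_lipschitz k x y t s xy.
  have h2 : `|s - t| <= e / 2 / (2 ^+ k * L + 1).
    near: t; apply/nbhs_normP; exists (e / 2 / (2 ^+ k * L + 1)).
      exact: divr_gt0.
    by move=> t /ltW.
  have h3 : 2 ^+ k * L * `|s - t| <= (2 ^+ k * L + 1) * `|s - t|.
    by rewrite ler_wpM2r// lerDl.
  rewrite ler_pdivlMr// mulrC in h2; lra.
- by apply: pE => // k; rewrite approx0 subrr enorm0 mulr_ge0// exprn_ge0.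
- by apply: pE => // k; rewrite approx1 subrr enorm0 mulr_ge0// exprn_ge0.
- by move=> t; rewrite in_itv/= => /andP[]; exact: pX.
apply: ge_ereal_sup => _ [r hr <-]; rewrite lee_fin.
apply: (@le_geometric (2 * K *+ size r) q) => // k.
have := @polygonal_sum_le p (arclen k x y) (2 * K * q ^+ k) r hr.
rewrite arclen0 subr0 => /(_ _)/le_trans; apply.
  move=> s t s0 st t1; have s1 := le_trans st t1; have t0 := le_trans s0 st.
  rewrite (le_trans (near_approx s t k s0 s1 t0 t1))// lerD2l.
  exact: approx_le_arclen.
by rewrite addrC; move: (2 * K) => M; rewrite mulrnAl; apply: lerD => //; exact: arclen1.
Unshelve. all: by end_near. Qed.

End Construction.

Lemma intrinsic_dist_le_arc X x y t : compact X -> 0 < t -> (t%:E <= reach X)%E ->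
  X x -> X y -> enorm (x - y) < 2 * t -> (intrinsic_dist X x y <= (arc t x y)%:E)%E.
Proof.
(* The initial chord itself serves as the bound [L]; being smaller than [2 * t], it makes the
   contraction factor [q] less than 1. *)
move=> cX t0 tr Xx Xy xyt; pose L := enorm (x - y).
pose q := 2 * t / (4 * t - L).
have q01 : 0 <= q < 1.
  have Lt : 0 < 4 * t - L by rewrite /L; clear tr; lra.
  rewrite /q divr_ge0//=; [|clear tr; lra..].
  by rewrite ltr_pdivrMr// /L; clear tr; lra.
pose good u v c := [/\ X c, arc t u c + arc t c v <= arc t u v,
  enorm (u - c) <= q * enorm (u - v) & enorm (c - v) <= q * enorm (u - v)].
pose mid u v := xget x [set c | good u v c].
have midP u v : close_in X L u v -> good u v (mid u v).
  by move=> [Xu Xv uvL]; apply: (@xgetPex _ x); exact: exists_midpoint.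
have [|||||| p pp pl] := @exists_dyadic_path X mid (arc t) L q cX q01 _ _ _ _ _ x y.
- by move=> u v [_ _ uvL]; apply: enorm_le_arc; exact: le_lt_trans xyt.
- by move=> u v /midP[].
- by move=> u v /midP[].
- by move=> u v /midP[].
- by move=> u v /midP[].
- by split.
by apply: le_trans pl; apply: ereal_inf_lbound; exists p.
Qed.

End DyadicPath.

(** * Path components and interleavings *)

Section Joined.
Context {R : realType}.

Lemma joined_in (T : topologicalType) (A : set T) x y :
  @joined R T A x y -> A x /\ A y.
Proof.
by move=> [p [_ <- <- pA]]; split; apply: pA; rewrite in_itv/= ?lexx ler01 ?lexx.
Qed.

Lemma joined_map (T U : topologicalType) (A : set T) (B : set U) (g : T -> U) x y :
  continuous g -> (forall t, A t -> B (g t)) ->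
  @joined R T A x y -> @joined R U B (g x) (g y).
Proof.
move=> cg AB [p [cp <- <- pA]]; exists (g \o p); split => //; last first.
  by move=> t /pA/AB.
by apply: within_continuous_comp => // z _; exact: cg.
Qed.

(** Along the path the indicator of [P] is continuous; if [P] were lost, the intermediate value
    theorem would give it the value [2^-1]. This transports a property along a path without
    subdividing it. *)
Lemma joined_locally_constant (T : topologicalType) (A : set T) (P : T -> Prop) x y :
  (forall z, A z -> \forall z' \near z, A z' -> (P z' <-> P z)) ->
  @joined R T A x y -> P x -> P y.
Proof.
move=> locP [p [cp p0 p1 pA]] Px; apply: contrapT => nPy.
pose g t : R := if `[< P (p t) >] then 1 else 0.
have cg : {within `[0, 1], continuous g}.
  move/subspace_continuousP : cp => cp; apply/subspace_continuousP => t tI.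
  apply: cvg_near_cst.
  have W : nbhs t [set t' | t' \in `[0, 1] -> A (p t') -> (P (p t') <-> P (p t))].
    by apply: (cp t tI [set z | A z -> (P z <-> P (p t))]); apply: locP; exact: pA.
  suff : nbhs t [set t' | t' \in `[0, 1] -> g t' = g t] by [].
  apply: (filterS _ W) => t' h t'I.
  have E := h t'I (pA _ t'I).
  rewrite /g; case: asboolP => [/E Pt|nPt]; case: asboolP => // Pt'.
  by case: nPt; apply/E.
have g0 : g 0 = 1 by rewrite /g p0; case: asboolP.
have g1 : g 1 = 0 by rewrite /g p1; case: asboolP.
have [||c _] := @IVT R g 0 1 2^-1 _ cg.
- exact: ler01.
- rewrite g0 g1 ge_min le_max; apply/andP; split; apply/orP; [right|left]; clear; lra.
by rewrite /g; case: asboolP => _ h; clear -h; lra.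
Qed.

(** Lifts a path of the ambient space to the subtype [B], whose initial topology reduces the
    continuity of the lift to that of [p]. *)
Lemma joined_sub (T : topologicalType) (B : set T) (A : set B) (p : R -> T)
    (x y : B) :
  {within `[0, 1], continuous p} -> p 0 = set_val x -> p 1 = set_val y ->
  (forall t, t \in `[0, 1] -> exists2 b : B, set_val b = p t & A b) ->
  @joined R B A x y.
Proof.
move=> cp p0 p1 pA; pose q t : B := xget x [set b | set_val b = p t].
have qE t : t \in `[0, 1] -> set_val (q t) = p t.
  by move=> /pA[b bt _]; apply: (@xgetPex _ x [set b | set_val b = p t]); exists b.
have I0 : (0 : R) \in `[0, 1] by rewrite in_itv/= lexx ler01.
have I1 : (1 : R) \in `[0, 1] by rewrite in_itv/= lexx ler01.
exists q; split.
- apply: continuous_comp_initial; apply: subspace_eq_continuous cp => t.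
  by rewrite inE/= => /qE.
- by apply: val_inj; rewrite -[LHS]/(set_val (q 0)) qE.
- by apply: val_inj; rewrite -[LHS]/(set_val (q 1)) qE.
- move=> t tI; have [b bt Ab] := pA t tI.
  by rewrite (_ : q t = b)//; apply: val_inj; rewrite -[LHS]/(set_val (q t)) qE.
Qed.

End Joined.

Section ComponentClasses.
Context {R : realType}.

(** The point is taken in [T] rather than in the subtype, so that one point can represent classes
    for several sets [A] without carrying membership proofs. *)
Definition class_of (T : topologicalType) (A : set T) t (c : pi0 R A) : Prop :=
  exists2 x : A, set_val x = t & \pi_(pi0 R A) x = c.

Context {T : topologicalType}.
Implicit Types (A B : set T).

Lemma class_of_exists A t : A t -> exists c : pi0 R A, class_of t c.
Proof.
move=> At; exists (\pi_(pi0 R A) (exist _ t (mem_set At))).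
by exists (exist _ t (mem_set At)).
Qed.

Lemma class_of_in A t (c : pi0 R A) : class_of t c -> A t.
Proof. by move=> [x <- _]; exact: set_mem (valP x). Qed.

Lemma class_of_joined A t u (c d : pi0 R A) : class_of t c -> class_of u d ->
  c = d <-> @joined R T A t u.
Proof. by move=> [x <- <-] [y <- <-]; exact: pi0_eqP. Qed.

Lemma class_of_repr A (c : pi0 R A) : exists t, class_of t c.
Proof. by exists (set_val (repr c)), (repr c) => //; exact: reprK. Qed.

Lemma class_of_map A B (AB : A `<=` B) t (c : pi0 R A) :
  class_of t c -> class_of t (pi0_map AB c).
Proof. by move=> [x <- <-]; exists (Defs.incl AB x) => //; rewrite pi0_mapE. Qed.

End ComponentClasses.

(** By totality each class has a related point, and by the second hypothesis all points related to
    one class are joined in [D]; the class of any of them defines [phi], without a choice of map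
    between the spaces. *)
Lemma pi0_relation (R : realType) (T U : topologicalType) (A : set T) (D : set U)
    (r : T -> U -> Prop) :
  (forall t, A t -> exists u, r t u) ->
  (forall t t' u u', @joined R T A t t' -> r t u -> r t' u' ->
    @joined R U D u u') ->
  exists phi : pi0 R A -> pi0 R D,
    forall t u c, class_of t c -> r t u -> class_of u (phi c).
Proof.
move=> tot wd.
have ex (c : pi0 R A) : exists d : pi0 R D,
    forall t u, class_of t c -> r t u -> class_of u d.
  have [t tc] := class_of_repr c; have At := class_of_in tc.
  have [u tu] := tot _ At.
  (* Compatibility applied to a constant path shows that a related point lies in [D], since [joined]
     entails membership of both ends. *)
  have [Du _] := joined_in (wd _ _ _ _ (joined_refl At) tu tu).
  have [d ud] := @class_of_exists R _ _ _ Du; exists d => t' u' t'c t'u'.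
  have uu' := wd _ _ _ _ (iffLR (class_of_joined tc t'c) erefl) tu t'u'.
  have [_ Du'] := joined_in uu'.
  have [d' ud'] := @class_of_exists R _ _ _ Du'; suff -> : d = d' by [].
  exact/(class_of_joined ud ud').
by have [phi phiP] := choice ex; exists phi => t u c; exact: phiP.
Qed.

Section RelationInterleaving.
Context {R : realType} {T U : topologicalType}.
Variables (g : T -> R) (h : U -> R) (e : {nonneg R}).
Variables (r : T -> U -> Prop) (r' : U -> T -> Prop).

(** Naturality is automatic, because the same related point serves every interval. The third and
    fourth hypotheses make the maps well defined, the last two give the composition identities. *)
Lemma interleaved_of_relations :
  (forall t, exists u, r t u) -> (forall u, exists t, r' u t) ->
  (forall (I : open_itv R) t t' u u', @joined R T (g @^-1` I) t t' ->
    r t u -> r t' u' -> @joined R U (h @^-1` thicken I e) u u') ->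
  (forall (I : open_itv R) u u' t t', @joined R U (h @^-1` I) u u' ->
    r' u t -> r' u' t' -> @joined R T (g @^-1` thicken I e) t t') ->
  (forall (I : open_itv R) t u t', itv_set I (g t) -> r t u -> r' u t' ->
    @joined R T (g @^-1` thicken (thicken I e) e) t t') ->
  (forall (I : open_itv R) u t u', itv_set I (h u) -> r' u t -> r t u' ->
    @joined R U (h @^-1` thicken (thicken I e) e) u u') ->
  interleaved e (pi0_precosheaf g) (pi0_precosheaf h).
Proof.
move=> tot tot' wd wd' rr' r'r.
pose phiS (I : open_itv R) := cid (pi0_relation (fun t _ => tot t) (wd I)).
pose psiS (I : open_itv R) := cid (pi0_relation (fun u _ => tot' u) (wd' I)).
pose phi I := sval (phiS I); have phiP I := svalP (phiS I).
pose psi I := sval (psiS I); have psiP I := svalP (psiS I).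
exists phi, psi; split.
- move=> I J IJ c; have [t tc] := class_of_repr c; have [u tu] := tot t.
  have h1 := phiP J _ _ _ (class_of_map (preimage_subset (f := g) IJ) tc) tu.
  have h2 := class_of_map (preimage_subset (f := h) (thickenS (e := e) IJ))
    (phiP I _ _ _ tc tu).
  by apply/(class_of_joined h1 h2); apply: joined_refl; exact: class_of_in h1.
- move=> I J IJ c; have [u uc] := class_of_repr c; have [t ut] := tot' u.
  have h1 := psiP J _ _ _ (class_of_map (preimage_subset (f := h) IJ) uc) ut.
  have h2 := class_of_map (preimage_subset (f := g) (thickenS (e := e) IJ))
    (psiP I _ _ _ uc ut).
  by apply/(class_of_joined h1 h2); apply: joined_refl; exact: class_of_in h1.
- move=> I c; have [t tc] := class_of_repr c; have [u tu] := tot t.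
  have [t' ut'] := tot' u; have h1 := psiP _ _ _ _ (phiP I _ _ _ tc tu) ut'.
  have h2 := class_of_map (preimage_subset (f := g) (@sub_thicken2 _ I e)) tc.
  apply/(class_of_joined h1 h2); apply: joined_sym.
  by apply: rr' tu ut'; have := class_of_in tc.
- move=> I c; have [u uc] := class_of_repr c; have [t ut] := tot' u.
  have [u' tu'] := tot t; have h1 := phiP _ _ _ _ (psiP I _ _ _ uc ut) tu'.
  have h2 := class_of_map (preimage_subset (f := h) (@sub_thicken2 _ I e)) uc.
  apply/(class_of_joined h1 h2); apply: joined_sym.
  by apply: r'r ut tu'; have := class_of_in uc.
Qed.

End RelationInterleaving.

(** * The Reeb graph and the neighbourhood graph of a dense sample *)

Section Intervals.
Context {R : realType}.
Implicit Types (I : open_itv R) (u v w : R).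

Lemma itv_between I u v w : itv_set I u -> itv_set I v ->
  Num.min u v <= w -> w <= Num.max u v -> itv_set I w.
Proof.
move=> /andP[lu uh] /andP[lv vh]; rewrite ge_min le_max => h1 h2.
apply/andP; split.
  by case/orP: h1 => h; [apply: lt_le_trans lu _|apply: lt_le_trans lv _]; rewrite lee_fin.
by case/orP: h2 => h; [apply: le_lt_trans uh|apply: le_lt_trans vh]; rewrite lee_fin.
Qed.

Lemma itv_conv I u v t : itv_set I u -> itv_set I v -> 0 <= t <= 1 ->
  itv_set I (u + t * (v - u)).
Proof.
move=> Iu Iv /andP[t0 t1]; apply: (itv_between Iu Iv).
  by rewrite ge_min; apply/orP; have [uv|vu] := leP u v; [left|right]; nra.
by rewrite le_max; apply/orP; have [uv|vu] := leP u v; [right|left]; nra.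
Qed.

Lemma itv_set_open I : open (itv_set I).
Proof.
rewrite (_ : itv_set I = [set r | lo I < r%:E]%E `&` [set r | r%:E < hi I]%E).
  by apply: openI; [exact: open_ereal_gt|exact: open_ereal_lt].
by apply/seteqP; split => r; [move=> /andP[]|move=> [? ?]; exact/andP].
Qed.

Lemma thicken_near I (e : {nonneg R}) u v : itv_set I u -> `|u - v| <= e%:num ->
  itv_set (thicken I e) v.
Proof.
move=> /andP[lu uh]; rewrite ler_norml => /andP[uv1 uv2]; apply/andP; split => /=.
  case: (lo I) lu => [r| |] /=; last by move=> _; exact: ltNyr.
  - rewrite lte_fin => ru; rewrite -EFinB lte_fin; clear uh; lra.
  - by rewrite ltNge leey.
case: (hi I) uh => [r| |] /=; last by rewrite ltNge leNye.
- rewrite lte_fin => ur; rewrite -EFinD lte_fin; clear lu; lra.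
- by move=> _; exact: ltry.
Qed.

End Intervals.

Section EdgePoints.
Context {R : realType} {V : choiceType}.
Implicit Types (x y v : V) (c t : R) (S : set V) (f : V -> R).

Lemma edge_point_swap x y c :
  edge_point x y c = edge_point y x (1 - c) :> {ptws V -> R}.
Proof. by apply/funext => v; rewrite /edge_point; ring. Qed.

Lemma edge_pointxx x y c : edge_point x x c = edge_point x y 1 :> {ptws V -> R}.
Proof. by apply/funext => v; rewrite /edge_point; ring. Qed.

Lemma edge_point_continuous x y : continuous (edge_point x y : R -> {ptws V -> R}).
Proof.
move=> c; apply/cvg_sup => v; apply: continuous_comp_initial => {}c.
rewrite /comp /proj /edge_point; apply: cvgD; apply: cvgM; try exact: cvg_cst.
  exact: cvg_id.
by apply: cvgB; [exact: cvg_cst|exact: cvg_id].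
Qed.

Lemma affine_extension_edge S f x y c : finite_set S -> S x -> S y ->
  affine_extension S f (edge_point x y c) = c * f x + (1 - c) * f y.
Proof.
move=> finS Sx Sy; rewrite /affine_extension fsbig_finite//=.
have pick z : S z -> \sum_(v <- fset_set S) (v == z)%:R * f v = f z.
  move=> Sz; rewrite (bigD1_seq z) ?fset_uniq//=; last first.
    by rewrite in_fset_set// inE.
  by rewrite eqxx mul1r big1 ?addr0// => v /negbTE ->; rewrite mul0r.
rewrite -[in RHS](pick x Sx) -[in RHS](pick y Sy) !mulr_sumr -big_split/=.
by apply: eq_bigr => v _; rewrite /edge_point mulrDl !mulrA.
Qed.

End EdgePoints.

Definition in_sub (T : Type) (A : set T) (t : T) (At : A t) : A :=
  exist (fun u => u \in A) t (mem_set At).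

(** * Interleaving of the Reeb graph with the neighbourhood graph *)

Section GraphInterleaving.
Context {R : realType} {m : nat}.
Variables (X S : set 'rV[R]_m) (f : 'rV[R]_m -> R) (delta : R) (e : {nonneg R}).
Hypothesis SX : S `<=` X.
Hypothesis finS : finite_set S.
Hypothesis dense : forall x, X x -> exists2 s, S s & enorm (x - s) <= delta.
Hypothesis cf : continuous (sigL X f).
Hypothesis delta_ge0 : 0 <= delta.
Hypothesis osc : forall x y, X x -> X y -> enorm (x - y) <= 2 * delta ->
  `|f x - f y| <= e%:num.
(** Only some height [h] between the two values is asked to lie in [I]: for a point in the middle of
    an edge, nothing is known about the values at the ends. *)
Hypothesis linked : forall (x y : X) (I : open_itv R) h,
  enorm (set_val x - set_val y) <= 2 * delta -> itv_set I h ->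
  Num.min (f (set_val x)) (f (set_val y)) <= h ->
  h <= Num.max (f (set_val x)) (f (set_val y)) ->
  @joined R X (sigL X f @^-1` thicken I e) x y.

Local Notation K := (@realization R _ S (delta_adjacent delta)).

Let g : X -> R := sigL X f.
Let G : K -> R := affine_extension S f \o set_val.

Let gE (x : X) : g x = f (set_val x).
Proof. by []. Qed.

Let XE (x : X) : X (set_val x).
Proof. exact: set_mem (valP x). Qed.

Let close_adjacent (x y : 'rV[R]_m) : enorm (x - y) <= 2 * delta ->
  x = y \/ delta_adjacent delta x y.
Proof. by move=> xy; have [->|nxy] := pselect (x = y); [left|right]. Qed.

Let close_trans (x y z : 'rV[R]_m) : enorm (x - y) <= delta -> enorm (x - z) <= delta ->
  enorm (y - z) <= 2 * delta.
Proof.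
move=> xy xz; apply: le_trans (enorm_triangle x y z) _.
by rewrite (enormB y x) mulr_natl mulr2n; exact: lerD.
Qed.

Let realizationP (k : K) : exists a b c, [/\ S a, S b,
  a = b \/ delta_adjacent delta a b, 0 <= c <= 1 & set_val k = edge_point a b c].
Proof. exact: set_mem (valP k). Qed.

Let vertex_exists s : S s -> exists k : K, set_val k = edge_point s s 1.
Proof.
move=> Ss; have Ks : K (edge_point s s 1).
  by exists s, s, 1; split => //; [left|rewrite ler01 lexx].
by exists (in_sub Ks).
Qed.

Let GE (k : K) a b c : S a -> S b -> set_val k = edge_point a b c ->
  G k = c * f a + (1 - c) * f b.
Proof. by move=> Sa Sb kE; rewrite /G /= kE affine_extension_edge. Qed.

Let G_vertex (k : K) s : S s -> set_val k = edge_point s s 1 -> G k = f s.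
Proof. by move=> Ss /GE ->//; rewrite mul1r subrr mul0r addr0. Qed.

Lemma edge_joined (k k' : K) a b c c' (J : open_itv R) :
  S a -> S b -> a = b \/ delta_adjacent delta a b ->
  set_val k = edge_point a b c -> set_val k' = edge_point a b c' ->
  0 <= c <= 1 -> 0 <= c' <= 1 -> itv_set J (G k) -> itv_set J (G k') ->
  @joined R K (G @^-1` J) k k'.
Proof.
move=> Sa Sb ab kE kE' /andP[c0 c1] /andP[c0' c1'] Jk Jk'.
pose p t : {ptws _ -> R} := edge_point a b (c + t * (c' - c)).
apply: (@joined_sub R _ K (G @^-1` J) p).
- apply: continuous_subspaceT => t.
  apply: (@continuous_comp R R {ptws 'rV[R]_m -> R} (fun t => c + t * (c' - c))
    (edge_point a b) t).
    apply: cvgD; first exact: cvg_cst.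
    by apply: cvgM; [exact: cvg_id|exact: cvg_cst].
  exact: edge_point_continuous.
- by rewrite /p mul0r addr0.
- by rewrite /p mul1r addrC subrK.
move=> t; rewrite in_itv/= => /andP[t0 t1].
have ct : 0 <= c + t * (c' - c) <= 1 by apply/andP; split; nra.
have Kp : K (p t) by exists a, b, (c + t * (c' - c)); split.
exists (in_sub Kp) => //.
have -> : G (in_sub Kp) = G k + t * (G k' - G k).
  rewrite (GE Sa Sb kE) (GE Sa Sb kE').
  by rewrite (@GE (in_sub Kp) a b (c + t * (c' - c)))//; ring.
by apply: itv_conv => //; apply/andP.
Qed.

Lemma vertices_joined (k k' : K) s s' (J : open_itv R) : S s -> S s' ->
  enorm (s - s') <= 2 * delta ->
  set_val k = edge_point s s 1 -> set_val k' = edge_point s' s' 1 ->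
  itv_set J (f s) -> itv_set J (f s') -> @joined R K (G @^-1` J) k k'.
Proof.
move=> Ss Ss' ss' kE kE' Js Js'.
apply: (@edge_joined k k' s s' 1 0) => //.
- exact: close_adjacent.
- by rewrite kE; exact: edge_pointxx.
- by rewrite kE' [RHS]edge_point_swap subr0; exact: edge_pointxx.
- by rewrite ler01 lexx.
- by rewrite ler01 lexx.
- by rewrite (G_vertex Ss kE).
- by rewrite (G_vertex Ss' kE').
Qed.

Definition support (k : K) (s : 'rV[R]_m) : Prop := 0 < set_val k s.

Let supportP (k : K) s a b c : 0 <= c <= 1 -> set_val k = edge_point a b c ->
  support k s -> s = a \/ s = b.
Proof.
move=> _ kE; rewrite /support kE /edge_point.
have [->|_] := eqVneq s a; first by left.
have [->|_] := eqVneq s b; first by right.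
by rewrite !mulr0 addr0 ltxx.
Qed.

Let support_exists (k : K) : exists2 x : X, S (set_val x) & support k (set_val x).
Proof.
have [a [b [c [Sa Sb _ /andP[c0 c1] kE]]]] := realizationP k.
have [cE|cn0] := eqVneq c 0; last first.
  exists (in_sub (SX Sa)) => //; rewrite /support kE /edge_point/=.
  rewrite eqxx mulr1 ltr_wpDr ?mulr_ge0 ?subr_ge0//.
  by rewrite lt_def cn0.
exists (in_sub (SX Sb)) => //; rewrite /support kE /edge_point/=.
by rewrite cE eqxx mul0r add0r subr0 mulr1 ltr01.
Qed.

Let support_near (k : K) s : support k s -> \forall k' \near k, support k' s.
Proof.
move=> ks; pose ev (u : {ptws 'rV[R]_m -> R}) : R := u s.
have cev : continuous (ev \o (set_val : K -> _)).
  move=> l; apply: continuous_comp; first exact: initial_continuous.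
  exact: (@proj_continuous _ (fun=> R) s).
by have := cev k [set r | 0 < r]; apply; exact: lt_nbhsr.
Qed.

(** Supporting vertices are ends of the edge carrying [k], and the height of [k] is a convex
    combination of the values at these ends, as [linked] requires. *)
Lemma support_joined (k : K) (x y : X) (I : open_itv R) : itv_set I (G k) ->
  support k (set_val x) -> support k (set_val y) ->
  @joined R X (g @^-1` thicken I e) x y.
Proof.
move=> Ik kx ky; have [a [b [c [Sa Sb ab c01 kE]]]] := realizationP k.
pose xa : X := in_sub (SX Sa).
pose xb : X := in_sub (SX Sb).
have ab2 : enorm (a - b) <= 2 * delta.
  by case: ab => [->|[]//]; rewrite subrr enorm0 mulr_ge0.
have Gk := GE Sa Sb kE; have /andP[c0 c1] := c01.
have J : @joined R X (g @^-1` thicken I e) xa xb.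
  apply: (linked (h := G k)) => //=; rewrite Gk.
    by rewrite ge_min; apply/orP; have [h|h] := leP (f a) (f b); [left|right]; nra.
  by rewrite le_max; apply/orP; have [h|h] := leP (f a) (f b); [right|left]; nra.
have [Ja Jb] := joined_in J.
have xE (z : X) s (Ss : S s) : set_val z = s -> z = in_sub (SX Ss).
  by move=> zs; exact: val_inj.
have [xa'|xb'] := supportP c01 kE kx; have [ya|yb] := supportP c01 kE ky.
- by rewrite (xE _ _ Sa xa') (xE _ _ Sa ya); exact: joined_refl.
- by rewrite (xE _ _ Sa xa') (xE _ _ Sb yb).
- by rewrite (xE _ _ Sb xb') (xE _ _ Sa ya); exact: joined_sym.
- by rewrite (xE _ _ Sb xb') (xE _ _ Sb yb); exact: joined_refl.
Qed.

Let sample_height (x : X) s (I : open_itv R) : S s ->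
  enorm (set_val x - s) <= delta -> itv_set I (g x) -> itv_set (thicken I e) (f s).
Proof.
move=> Ss xs Ix; apply: thicken_near Ix _; apply: osc => //; first exact: SX.
by apply: le_trans xs _; rewrite mulr_natl mulr2n lerDl.
Qed.

Local Notation Rg := (reeb_graph g).
Local Notation piR := (\pi_({eq_quot reeb_rel g}) : X -> Rg).

Definition reeb_to_graph (q : Rg) (k : K) : Prop := exists (x : X) s,
  [/\ piR x = q, S s, enorm (set_val x - s) <= delta & set_val k = edge_point s s 1].

Definition graph_to_reeb (k : K) (q : Rg) : Prop := exists x : X,
  [/\ S (set_val x), support k (set_val x) & piR x = q].

Let sampleJ (I : open_itv R) (k0 : K) (x : X) : Prop := forall s k, S s ->
  enorm (set_val x - s) <= delta -> set_val k = edge_point s s 1 ->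
  @joined R K (G @^-1` thicken I e) k0 k.

(** [S] is finite and [delta < enorm (x - s)] is an open condition on [x], so for [x'] near [x] a
    sample point within [delta] of [x'] is also within [delta] of [x]. Vertices chosen for [x] and
    [x'] are thus at most [2 * delta] apart, hence equal or adjacent. *)
Let sampleJ_near (I : open_itv R) k0 (x : X) : itv_set I (g x) ->
  \forall x' \near x, itv_set I (g x') /\ (sampleJ I k0 x' <-> sampleJ I k0 x).
Proof.
move=> Ix.
have nI : \forall x' \near x, itv_set I (g x').
  apply: (cf (x := x)); apply: open_nbhs_nbhs; split => //; exact: itv_set_open.
have nS : \forall x' \near x, forall s, S s -> enorm (set_val x' - s) <= delta ->
    enorm (set_val x - s) <= delta.
  have /finite_fsetP[D SD] := finS.
  suff : nbhs x (\bigcap_(s in [set` D])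
      [set x' : X | enorm (set_val x' - s) <= delta -> enorm (set_val x - s) <= delta]).
    by apply: filterS => x' h s; rewrite SD => /h.
  apply: filter_bigI => s _.
  have [xs|xs] := leP (enorm (set_val x - s)) delta; first exact: filterE.
  have cd : continuous (fun x' : X => enorm (set_val x' - s)).
    move=> z; apply: (@continuous_comp X 'rV[R]_m R set_val (fun y => enorm (y - s)) z).
      exact: initial_continuous.
    exact: edist_continuous.
  have : \forall x' \near x, delta < enorm (set_val x' - s).
    by apply: (cd x [set r | delta < r]); exact: lt_nbhsr.
  by apply: filterS => x' /=; rewrite ltNge => /negbTE ->.
apply: filterS2 nI nS => x' Ix' sub; split => //.
have [s0 Ss0 xs0] := dense (XE x').
have [k1 k1E] := vertex_exists Ss0.
split => h s k Ss xs kE.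
  have h1 := h s0 k1 Ss0 xs0 k1E; apply: joined_trans h1 _.
  apply: (vertices_joined Ss0 Ss _ k1E kE).
  - by apply: close_trans xs; exact: sub.
  - exact: sample_height Ix'.
  - exact: sample_height Ix.
by apply: h kE => //; exact: sub.
Qed.

Let sampleJ_joined (I : open_itv R) k0 x x' :
  @joined R X (g @^-1` I) x x' -> sampleJ I k0 x -> sampleJ I k0 x'.
Proof.
apply: joined_locally_constant => z Iz.
by apply: filterS (sampleJ_near k0 Iz) => z' [].
Qed.

Let piR_joined (I : open_itv R) x x' : itv_set I (g x) -> piR x = piR x' ->
  @joined R X (g @^-1` I) x x'.
Proof.
move=> Ix xx'.
have /eqP : \pi_({eq_quot reeb_rel g}) x = \pi_({eq_quot reeb_rel g}) x' by exact: xx'.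
by rewrite eqmodE => /asboolP; apply: sub_joined => z /= ->.
Qed.

Let reeb_sampleJ (I : open_itv R) k0 (q : Rg) : Prop :=
  forall x, piR x = q -> sampleJ I k0 x.

(** Representatives of one Reeb class are joined inside their level set, along which [sampleJ] is
    transported, so that testing one of them suffices. *)
Let reeb_sampleJE (I : open_itv R) k0 x : itv_set I (g x) ->
  reeb_sampleJ I k0 (piR x) <-> sampleJ I k0 x.
Proof.
move=> Ix; split => [h|h x' /esym xx']; first exact: h.
exact: sampleJ_joined (piR_joined Ix xx') h.
Qed.

(* The quotient topology turns local constancy on X into local constancy on the
   Reeb graph. *)
Let reeb_sampleJ_near (I : open_itv R) k0 (q : Rg) : (reeb_fun g @^-1` I) q ->
  \forall q' \near q, (reeb_fun g @^-1` I) q' ->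
    (reeb_sampleJ I k0 q' <-> reeb_sampleJ I k0 q).
Proof.
move=> Iq; pose D := [set q' : Rg | (reeb_fun g @^-1` I) q' /\
  (reeb_sampleJ I k0 q' <-> reeb_sampleJ I k0 q)].
suff : open D by rewrite openE => /(_ q (conj Iq (iff_refl _))); apply: filterS => q' [].
suff : open (piR @^-1` D) by [].
rewrite openE => x [/= +]; rewrite reeb_funE => Ix xq.
apply: filterS (sampleJ_near k0 Ix) => x' [Ix' xx']; split.
  by rewrite /= reeb_funE.
by rewrite (reeb_sampleJE _ Ix') xx' -(reeb_sampleJE _ Ix).
Qed.

Let piR_map (I : open_itv R) x y : @joined R X (g @^-1` I) x y ->
  @joined R Rg (reeb_fun g @^-1` I) (piR x) (piR y).
Proof.
apply: joined_map; first exact: pi_continuous.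
by move=> t; rewrite /preimage/= reeb_funE.
Qed.

Let piR_surj (q : Rg) : exists x, piR x = q.
Proof. by exists (repr (q : {eq_quot reeb_rel g})); exact: reprK. Qed.

Let graph_supportJ (I : open_itv R) (x0 : X) (k : K) : Prop := forall x : X,
  support k (set_val x) -> S (set_val x) -> @joined R X (g @^-1` thicken I e) x0 x.

(** A positive barycentric coordinate stays positive nearby, so some vertex [x1] supports both [k]
    and [k']; [support_joined] links every other supporting vertex to it. *)
Let graph_supportJ_near (I : open_itv R) x0 (k : K) : (G @^-1` I) k ->
  \forall k' \near k, (G @^-1` I) k' ->
    (graph_supportJ I x0 k' <-> graph_supportJ I x0 k).
Proof.
move=> Ik; have [x1 Sx1 kx1] := support_exists k.
apply: filterS (support_near kx1) => k' k'x1 Ik'.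
split => h x kx Sx; (apply: joined_trans (h x1 _ Sx1) _; first by []).
  exact: support_joined Ik kx1 kx.
exact: support_joined Ik' k'x1 kx.
Qed.

Let reeb_to_graph_total q : exists k, reeb_to_graph q k.
Proof.
have [x <-] := piR_surj q; have [s Ss xs] := dense (XE x).
by have [k kE] := vertex_exists Ss; exists k, x, s.
Qed.

Let graph_to_reeb_total k : exists q, graph_to_reeb k q.
Proof. by have [x Sx kx] := support_exists k; exists (piR x), x. Qed.

Let reeb_to_graph_joined (I : open_itv R) q q' k k' :
  @joined R Rg (reeb_fun g @^-1` I) q q' -> reeb_to_graph q k ->
  reeb_to_graph q' k' -> @joined R K (G @^-1` thicken I e) k k'.
Proof.
move=> qq' [x [s [xq Ss xs kE]]] [x' [s' [xq' Ss' xs' kE']]].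
have [Iq Iq'] := joined_in qq'; rewrite /= -xq reeb_funE in Iq.
suff : reeb_sampleJ I k q' by move=> /(_ x' xq' s' k'); exact.
apply: joined_locally_constant (@reeb_sampleJ_near I k) qq' _.
rewrite -xq; apply/(reeb_sampleJE _ Iq) => s1 k1 Ss1 xs1 k1E.
apply: (vertices_joined Ss Ss1 _ kE k1E).
- exact: close_trans xs1.
- exact: sample_height Iq.
- exact: sample_height Iq.
Qed.

Let graph_to_reeb_joined (I : open_itv R) k k' q q' :
  @joined R K (G @^-1` I) k k' -> graph_to_reeb k q -> graph_to_reeb k' q' ->
  @joined R Rg (reeb_fun g @^-1` thicken I e) q q'.
Proof.
move=> kk' [x [Sx kx <-]] [x' [Sx' kx' <-]]; apply: piR_map.
have [Ik Ik'] := joined_in kk'.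
suff : graph_supportJ I x k' by exact.
apply: joined_locally_constant (@graph_supportJ_near I x) kk' _.
by move=> y ky Sy; exact: support_joined Ik kx ky.
Qed.

Lemma reeb_graph_interleaved :
  interleaved e (reeb_precosheaf g) (pl_reeb S delta f).
Proof.
apply: (@interleaved_of_relations R Rg K (reeb_fun g) G e reeb_to_graph graph_to_reeb).
- exact: reeb_to_graph_total.
- exact: graph_to_reeb_total.
- exact: reeb_to_graph_joined.
- exact: graph_to_reeb_joined.
- move=> I q k q' Iq [x [s [xq Ss xs kE]]] [y [Sy ky <-]].
  rewrite -xq reeb_funE in Iq; rewrite -xq; apply: piR_map.
  have ys : set_val y = s by case: (supportP _ kE ky) => //; rewrite ler01 lexx.
  apply: (sub_joined (A := g @^-1` thicken I e)).
    by apply: preimage_subset; exact: sub_thicken.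
  apply: (linked (h := g x)) => //.
  + by rewrite ys (le_trans xs)// mulr_natl mulr2n lerDl.
  + by rewrite gE ge_min lexx.
  + by rewrite gE le_max lexx.
- move=> I k q k' Ik kq qk'; have [x [Sx kx xq]] := kq.
  (* The vertex [k1] over [x] is a stopover: the edge carrying [k] joins [k] to it, and since [x] is
     a sample point at distance 0 from itself, [reeb_to_graph_joined] joins it to [k']. *)
  have [k1 k1E] := vertex_exists Sx.
  have [Jx _] := joined_in (support_joined Ik kx kx).
  have [a [b [c [Sa Sb ab c01 kE]]]] := realizationP k.
  have kk1 : @joined R K (G @^-1` thicken I e) k k1.
    have Gk : itv_set (thicken I e) (G k) by apply: sub_thicken.
    have Gk1 : itv_set (thicken I e) (G k1) by rewrite (G_vertex Sx k1E).
    have I01 : 0 <= (0 : R) <= 1 by rewrite lexx ler01.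
    have I11 : 0 <= (1 : R) <= 1 by rewrite lexx ler01.
    have [xa|xb] := supportP c01 kE kx.
      apply: (edge_joined (c := c) (c' := 1) Sa Sb ab) => //.
      by rewrite k1E xa; exact: edge_pointxx.
    apply: (edge_joined (c := c) (c' := 0) Sa Sb ab) => //.
    by rewrite k1E xb [RHS]edge_point_swap subr0; exact: edge_pointxx.
  apply: (joined_trans (y := k1)).
    apply: sub_joined kk1; apply: preimage_subset; exact: sub_thicken.
  apply: (reeb_to_graph_joined (q := q) (q' := q)) qk'.
    by apply: joined_refl; rewrite /= -xq reeb_funE.
  by exists x, (set_val x); split => //; rewrite subrr enorm0.
Qed.

End GraphInterleaving.

(** * Paths of nearly minimal length *)

Section NearOptimalPaths.
Context {R : realType} {m : nat}.
Implicit Types (x y z : 'rV[R]_m) (X : set 'rV[R]_m) (p : R -> 'rV[R]_m) (s t : R).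

Lemma polygonal_sum_ge0 p (r : seq R) : 0 <= polygonal_sum p r.
Proof. by apply: sumr_ge0 => k _; exact: enorm_ge0. Qed.

Lemma polygonal_sum_le_length p (r : seq R) : itv_partition 0 1 r ->
  ((polygonal_sum p r)%:E <= path_length p)%E.
Proof. by move=> hr; apply: ereal_sup_ubound; exists r. Qed.

Lemma intrinsic_dist_ge0 X x y : (0 <= intrinsic_dist X x y)%E.
Proof.
apply: le_ereal_inf_tmp => _ [p _ <-].
have := @polygonal_sum_le_length p [:: 1] (itv_partition1 ltr01).
by apply: le_trans; rewrite lee_fin polygonal_sum_ge0.
Qed.

Lemma polygonal_sum_cons p t (r : seq R) :
  polygonal_sum p (t :: [seq (1 - t) * s + t | s <- r]) =
  enorm (p t - p 0) + polygonal_sum (fun s => p ((1 - t) * s + t)) r.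
Proof.
rewrite /polygonal_sum /= size_map big_nat_recl//; congr (_ + _).
apply: eq_big_nat => k kr /=.
have E j : (j <= size r)%N ->
    nth 1 (t :: [seq (1 - t) * s + t | s <- r]) j = (1 - t) * nth 1 (0 :: r) j + t.
  case: j => [|j] jr /=; first by rewrite mulr0 add0r.
  exact: (nth_map 1).
have := E k.+1 kr; have := E k (ltnW kr); move=> /= -> ->.
by [].
Qed.

Lemma polygonal_sum_rcons p t (r : seq R) : nth 1 (0 :: r) (size r) = 1 ->
  polygonal_sum p (rcons [seq t * s | s <- r] 1) =
  polygonal_sum (fun s => p (t * s)) r + enorm (p 1 - p t).
Proof.
move=> lr; rewrite /polygonal_sum size_rcons size_map big_nat_recr//=.
have E j : (j <= size r)%N ->
    nth 1 (0 :: rcons [seq t * s | s <- r] 1) j = t * nth 1 (0 :: r) j.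
  case: j => [|j] jr /=; first by rewrite mulr0.
  by rewrite nth_rcons size_map jr (nth_map 1).
have -> : nth 1 (rcons [seq t * s | s <- r] 1) (size r) = 1.
  by rewrite nth_rcons size_map ltnn eqxx.
have := E _ (leqnn (size r)); rewrite lr mulr1 /= => ->; congr (_ + _).
apply: eq_big_nat => k kr /=.
by have := E k.+1 kr; have := E k (ltnW kr); move=> /= -> ->.
Qed.

Lemma itv_partition_cons_map t (r : seq R) : 0 < t < 1 -> itv_partition 0 1 r ->
  itv_partition 0 1 (t :: [seq (1 - t) * s + t | s <- r]).
Proof.
move=> /andP[t0 t1] [pr /eqP lr]; pose phi s := (1 - t) * s + t.
have phi0 : phi 0 = t by rewrite /phi mulr0 add0r.
split; rewrite /= -/phi; last by rewrite -phi0 last_map lr /phi mulr1 subrK.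
rewrite t0/=; rewrite -[X in path _ X _]phi0; apply: homo_path pr => u v uv.
by rewrite /phi ltrD2r ltr_pM2l// subr_gt0.
Qed.

Lemma itv_partition_rcons_map t (r : seq R) : 0 < t < 1 -> itv_partition 0 1 r ->
  itv_partition 0 1 (rcons [seq t * s | s <- r] 1).
Proof.
move=> /andP[t0 t1] [pr /eqP lr]; split; last by rewrite last_rcons.
have phi0 : t * 0 = 0 by rewrite mulr0.
rewrite -[X in path _ X _]phi0 rcons_path (last_map (fun s => t * s)) lr mulr1 t1 andbT.
by apply: homo_path pr => u v uv; rewrite ltr_pM2l.
Qed.

(** Replacing one of the two subpaths by its chord does not increase the length: a partition for the
    other subpath, rescaled and completed by one node, is a partition for [p]. *)
Lemma le_subpath_dist X p x y t (l : R) : is_path_in X p x y ->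
  (path_length p <= l%:E)%E -> 0 < t < 1 ->
  ((enorm (p t - x))%:E + intrinsic_dist X (p t) y <= l%:E)%E /\
  (intrinsic_dist X x (p t) + (enorm (y - p t))%:E <= l%:E)%E.
Proof.
move=> [cp p0 p1 pX] pl t01; have /andP[t0 t1] := t01; split.
- rewrite addeC -leeBrDr//; pose q s := p ((1 - t) * s + t).
  apply: (@le_trans _ _ (path_length q)).
    apply: ereal_inf_lbound; exists q => //; split.
    + by apply: within_affine_comp => // s; rewrite !in_itv/= => /andP[? ?]; nra.
    + by rewrite /q mulr0 add0r.
    + by rewrite /q mulr1 subrK.
    + by move=> s; rewrite in_itv/= => /andP[? ?]; apply: pX; rewrite in_itv/=; nra.
  apply: ge_ereal_sup => _ [r hr <-]; rewrite leeBrDr// -EFinD.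
  apply: le_trans pl; rewrite addrC -p0 -polygonal_sum_cons.
  by apply: polygonal_sum_le_length; exact: itv_partition_cons_map.
rewrite -leeBrDr//; pose q s := p (t * s + 0).
apply: (@le_trans _ _ (path_length q)).
  apply: ereal_inf_lbound; exists q => //; split.
  + by apply: within_affine_comp => // s; rewrite !in_itv/= => /andP[? ?]; nra.
  + by rewrite /q mulr0 add0r.
  + by rewrite /q mulr1 addr0.
  + by move=> s; rewrite in_itv/= => /andP[? ?]; apply: pX; rewrite in_itv/=; nra.
apply: ge_ereal_sup => _ [r hr <-]; rewrite leeBrDr// -EFinD.
apply: le_trans pl; rewrite -p1.
have -> : polygonal_sum q r = polygonal_sum (fun s => p (t * s)) r.
  by rewrite /q; under eq_fun do rewrite addr0.
rewrite -polygonal_sum_rcons ?(itv_partition_nth_size _ hr)//.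
by apply: polygonal_sum_le_length; exact: itv_partition_rcons_map.
Qed.

Lemma within_continuous_near X (f : 'rV[R]_m -> R) x (e : R) :
  {within X, continuous f} -> X x -> 0 < e ->
  exists2 rho, 0 < rho &
    forall z, X z -> enorm (z - x) < rho -> `|f z - f x| < e.
Proof.
move=> /subspace_continuousP cf Xx e0.
have W : nbhs x [set z | X z -> `|f z - f x| < e].
  have := cf x Xx [set v | `|v - f x| < e]; apply.
  apply/nbhs_normP; exists e => // v /=; by rewrite distrC.
have /nbhs_ballP[rho rho0 hW] := W; exists rho => // z Xz zx.
apply: hW Xz; rewrite -ball_normE /ball_/= -normrN opprB.
exact: le_lt_trans (norm_le_enorm _) zx.
Qed.

Lemma itv_set_near (I : open_itv R) h : itv_set I h ->
  exists2 e, 0 < e & forall v, `|v| < e -> itv_set I (h + v).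
Proof.
move=> Ih; have : nbhs h (itv_set I).
  by apply: open_nbhs_nbhs; split => //; exact: itv_set_open.
move=> /nbhs_normP[e e0 he]; exists e => // v ve; apply: he => /=.
by rewrite opprD addNKr normrN.
Qed.

Lemma modulus_le X (f : 'rV[R]_m -> R) w x y (r : R) :
  modulus_of_continuity X f w -> X x -> X y -> 0 <= r ->
  (intrinsic_dist X x y <= r%:E)%E -> `|f x - f y| <= w r.
Proof.
move=> [w0 wge wmono hw] Xx Xy r0 dr; apply: le_trans (hw _ _ Xx Xy) _.
have d0 := intrinsic_dist_ge0 X x y; apply: wmono; first exact: fine_ge0.
by rewrite -lee_fin fineK// ge0_fin_numE// (le_lt_trans dr)// ltry.
Qed.

(* No geodesic is needed: on a path of length less than [r + rho], a point at
   distance at least [rho] from both ends is within [r] of both ends, and points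
   near an end are controlled by the continuity of [f] there. *)
Lemma joined_of_intrinsic_dist X (f : 'rV[R]_m -> R) w (x y : X) (I : open_itv R)
    h r (e : {nonneg R}) :
  {within X, continuous f} -> modulus_of_continuity X f w ->
  0 <= r -> w r <= e%:num ->
  (intrinsic_dist X (set_val x) (set_val y) <= r%:E)%E -> itv_set I h ->
  Num.min (f (set_val x)) (f (set_val y)) <= h ->
  h <= Num.max (f (set_val x)) (f (set_val y)) ->
  @joined R X (sigL X f @^-1` thicken I e) x y.
Proof.
move=> cf mw r0 we dxy Ih.
have Xx : X (set_val x) := set_mem (valP x).
have Xy : X (set_val y) := set_mem (valP y).
rewrite ge_min le_max => hmin hmax.
have fxy := le_trans (modulus_le mw Xx Xy r0 dxy) we.
have [g0 g00 hg] := itv_set_near Ih.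
have [rx rx0 hx] := within_continuous_near cf Xx g00.
have [ry ry0 hy] := within_continuous_near cf Xy g00.
pose rho := Num.min rx ry; have rho0 : 0 < rho by rewrite lt_min rx0.
have [|_ [p pp <-] plt] := @lb_ereal_inf_adherent R
    [set path_length p | p in [set p | is_path_in X p (set_val x) (set_val y)]]
    rho rho0.
  by rewrite ge0_fin_numE ?intrinsic_dist_ge0// (le_lt_trans dxy) ?ltry.
have {plt}pl : (path_length p <= (r + rho)%:E)%E.
  by rewrite EFinD (le_trans (ltW plt))// leeD2r.
have [cp p0 p1 pX] := pp.
have fx_h : `|f (set_val x) - h| <= e%:num.
  move: fxy hmin hmax; rewrite !ler_norml; clear -R.
  move=> /andP[? ?] /orP[?|?] /orP[?|?]; apply/andP; split; lra.
have fy_h : `|f (set_val y) - h| <= e%:num.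
  move: fxy hmin hmax; rewrite !ler_norml; clear -R.
  move=> /andP[? ?] /orP[?|?] /orP[?|?]; apply/andP; split; lra.
have near_end (u z : 'rV[R]_m) : `|f u - h| <= e%:num -> `|f z - f u| < g0 ->
    itv_set (thicken I e) (f z).
  move=> uh zu; apply: thicken_near (hg _ zu) _.
  have -> : h + (f z - f u) - f z = h - f u by ring.
  by rewrite distrC.
apply: (joined_sub cp p0 p1) => t tI; have Xz := pX t tI.
exists (in_sub Xz) => //; rewrite /preimage/= /sigL/=.
have [zx|zx] := ltP (enorm (p t - set_val x)) rho.
  apply: (near_end (set_val x)) => //; apply: hx => //.
  by rewrite (lt_le_trans zx)// ge_min lexx.
have [zy|zy] := ltP (enorm (p t - set_val y)) rho.
  apply: (near_end (set_val y)) => //; apply: hy => //.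
  by rewrite (lt_le_trans zy)// ge_min lexx orbT.
have t01 : 0 < t < 1.
  move: tI; rewrite in_itv/= !le_eqVlt => /andP[/predU1P[t0|->] /predU1P[t1|->]]//.
  - by move: zx; rewrite -t0 p0 subrr enorm0 leNgt rho0.
  - by move: zx; rewrite -t0 p0 subrr enorm0 leNgt rho0.
  - by move: zy; rewrite t1 p1 subrr enorm0 leNgt rho0.
(* Away from both ends, the chord to one end uses up the excess [rho] over [r] and leaves at most
   [r] for the intrinsic distance to the other end. *)
have [d1 d2] := le_subpath_dist pp pl t01.
have dy : (intrinsic_dist X (p t) (set_val y) <= r%:E)%E.
  rewrite -(leeD2lE (x := rho%:E))// -EFinD (addrC rho).
  by apply: le_trans d1; rewrite leeD2r// lee_fin.
have dx : (intrinsic_dist X (set_val x) (p t) <= r%:E)%E.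
  rewrite -(leeD2rE (x := rho%:E))// -EFinD.
  by apply: le_trans d2; rewrite leeD2l// lee_fin enormB.
have h1 := le_trans (modulus_le mw Xx Xz r0 dx) we.
have h2 := le_trans (modulus_le mw Xz Xy r0 dy) we.
(* [f (p t)] is within [e] of both end values, hence of [h], which lies between them. *)
apply: thicken_near Ih _; move: h1 h2 hmin hmax; rewrite !ler_norml; clear -R.
by move=> /andP[? ?] /andP[? ?] /orP[?|?] /orP[?|?]; apply/andP; split; lra.
Qed.

End NearOptimalPaths.

(** * The interleaving bound for a dense sample *)

Section Deterministic.
Context {R : realType} {m : nat}.
Implicit Types (X S : set 'rV[R]_m) (f : 'rV[R]_m -> R) (w : R -> R) (delta : R).

Lemma eta_ge0 X delta : 0 < delta -> (delta%:E < reach X)%E ->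
  0 <= eta (reach X) delta.
Proof.
rewrite /eta; case: (reach X) => [t||] d0 //= => [dt|_]; last by rewrite mulr_ge0// ltW.
rewrite lte_fin in dt; have t0 : 0 < t by exact: lt_trans dt.
have [|/andP[a0 _] _] := @asin_itv R (delta / t); last first.
  by rewrite mulr_ge0// mulr_ge0// ltW.
by rewrite (divr_ge0 (ltW d0) (ltW t0))/= ler_pdivrMr// mul1r ltW.
Qed.

Lemma arc_le_eta (x y : 'rV[R]_m) delta (t : R) : 0 < delta -> delta < t ->
  enorm (x - y) <= 2 * delta -> arc t x y <= 2 * t * asin (delta / t).
Proof.
move=> d0 dt xy; have t0 : 0 < t by exact: lt_trans dt.
rewrite /arc ler_pM2l ?mulr_gt0//; apply: ler_asin.
- by rewrite divr_ge0 ?enorm_ge0// mulr_ge0// ltW.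
- rewrite ler_pdivrMr ?mulr_gt0// mulrCA divfK ?gt_eqF//.
- by rewrite ler_pdivrMr// mul1r ltW.
Qed.

Lemma intrinsic_dist_le_eta X (x y : 'rV[R]_m) delta : compact X -> X x -> X y ->
  0 < delta -> (delta%:E < reach X)%E -> enorm (x - y) <= 2 * delta ->
  (intrinsic_dist X x y <= (eta (reach X) delta)%:E)%E.
Proof.
move=> cX Xx Xy d0 dr xy.
have bound (t : R) : delta < t -> (t%:E <= reach X)%E ->
    (intrinsic_dist X x y <= (2 * t * asin (delta / t))%:E)%E.
  move=> dt tr; apply: (@le_trans _ _ (arc t x y)%:E).
    apply: intrinsic_dist_le_arc => //; first exact: lt_trans dt.
    by rewrite (le_lt_trans xy)// ltr_pM2l.
  by rewrite lee_fin; exact: arc_le_eta.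
rewrite /eta; case: (reach X) dr bound => [t||] //= dr bound.
  by apply: bound; rewrite // -lte_fin.
(* With infinite reach every radius is allowed. This [t] solves [2 * t * delta = (2 * delta + e) *
   (t - delta)], to which the claim is reduced by bounding [asin u] by [u / (1 - u)]. *)
apply/lee_addgt0Pr => e e0; pose t := delta * (2 * delta + e) / e.
have te : e * t = delta * (2 * delta + e) by rewrite /t; field; lra.
have dt : delta < t by rewrite -(ltr_pM2l e0) te; nra.
have t0 : 0 < t by exact: lt_trans dt.
apply: le_trans (bound t dt (leey _)) _; rewrite -EFinD lee_fin.
set u := delta / t; have ut : u * t = delta by rewrite /u divfK// gt_eqF.
have u0 : 0 < u by exact: divr_gt0.
have u1 : u < 1 by rewrite /u ltr_pdivrMr// mul1r.
have u01 : 0 <= u <= 1 by rewrite !ltW.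
have h := asin_mul_sqrt_le u01; have [/andP[a0 _] _] := asin_itv u01.
have s1 : 1 - u <= Num.sqrt (1 - u ^+ 2).
  have u1' : 0 <= 1 - u by rewrite subr_ge0 ltW.
  rewrite -[leLHS](ger0_norm u1') -sqrtr_sqr ler_wsqrtr//; nra.
have h2 : asin u * (1 - u) <= u by apply: le_trans h; rewrite ler_wpM2l.
have tu : 0 < t - delta by rewrite subr_gt0.
rewrite -(ler_pM2r tu).
have -> : 2 * t * asin u * (t - delta) = 2 * t ^+ 2 * (asin u * (1 - u)).
  by rewrite -ut; ring.
apply: (@le_trans _ _ (2 * t ^+ 2 * u)); first by rewrite ler_wpM2l// mulr_ge0// sqr_ge0.
have -> : 2 * t ^+ 2 * u = 2 * t * delta by rewrite -ut; ring.
lra.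
Qed.

Lemma interleaving_dist_le X S f w delta : compact X -> {within X, continuous f} ->
  modulus_of_continuity X f w -> 0 < delta -> (delta%:E < reach X)%E ->
  finite_set S -> S `<=` X ->
  (forall x, X x -> exists2 s, S s & enorm (x - s) <= delta) ->
  (interleaving_dist (reeb_precosheaf (sigL X f)) (pl_reeb S delta f) <=
    (w (eta (reach X) delta))%:E)%E.
Proof.
move=> cX cf mw d0 dr finS SX dense; set r := eta _ _.
have r0 : 0 <= r by exact: eta_ge0.
have wr0 : 0 <= w r by case: mw => _ wge _ _; exact: wge.
have dist_le x y : X x -> X y -> enorm (x - y) <= 2 * delta ->
    (intrinsic_dist X x y <= r%:E)%E by move=> *; exact: intrinsic_dist_le_eta.
apply: ereal_inf_lbound; exists (NngNum wr0) => //=.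
apply: reeb_graph_interleaved => //.
- exact/subspace_sigL_continuousP.
- exact: ltW.
- by move=> x y Xx Xy xy; apply: (modulus_le mw) => //; exact: dist_le.
- move=> x y I h xy Ih; apply: (joined_of_intrinsic_dist cf mw r0) => //.
  by apply: dist_le => //; exact: set_mem (valP _).
Qed.

Lemma lipschitz1_modulus X f :
  (forall x y, X x -> X y -> (intrinsic_dist X x y < +oo)%E) ->
  lipschitz1 X f -> modulus_of_continuity X f id.
Proof.
move=> fin lip; split => // x y Xx Xy.
rewrite -lee_fin fineK; first exact: lip.
by rewrite ge0_fin_numE ?intrinsic_dist_ge0//; exact: fin.
Qed.

Lemma eta_le_linear X delta : 0 < delta -> ((2 * delta)%:E < reach X)%E ->
  eta (reach X) delta <= 2 * pi / 3 * delta.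
Proof.
rewrite /eta; case: (reach X) => [t||] d0 //= => [dt|_].
  rewrite lte_fin in dt; have t0 : 0 < t by lra.
  have := @asin_le_pi3 R (delta / t) => h.
  have {}h : asin (delta / t) <= pi / 3 * (delta / t).
    by apply: h; rewrite (divr_ge0 (ltW d0) (ltW t0))/= ler_pdivrMr//; lra.
  apply: le_trans (ler_wpM2l _ h) _; first by rewrite mulr_ge0// ltW.
  by rewrite le_eqVlt; apply/orP; left; apply/eqP; field; lra.
by rewrite ler_pM2r//; have := @pi_ge3 R; lra.
Qed.

End Deterministic.

(** * Density of a random sample *)

Section BorelSets.
Context {R : realType} {m : nat}.
Implicit Types (U X : set 'rV[R]_m).

Lemma open_borel U : open U -> measurable (U : set (borel R m)).
Proof. by move=> oU; exact: sub_sigma_algebra. Qed.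

Lemma closed_borel X : closed X -> measurable (X : set (borel R m)).
Proof.
move=> cX; rewrite -[X]setCK; apply: measurableC; apply: open_borel.
exact: closed_openC.
Qed.

(** Balls are those of the sup norm, so a rational centre is found coordinate by coordinate. A
    radius below [e / 2] keeps its ball inside the ball of radius [e] around [x]. *)
Lemma exists_rat_ball U (x : 'rV[R]_m) : open U -> U x ->
  exists (q : 'rV[rat]_m) (k : nat),
    ball (map_mx (ratr : rat -> R) q) k.+1%:R^-1 x /\
    ball (map_mx (ratr : rat -> R) q) k.+1%:R^-1 `<=` U.
Proof.
move=> oU Ux; have /nbhs_ballP[e /= e0 eU] := open_nbhs_nbhs (conj oU Ux).
have [k ke] : exists k : nat, (k.+1%:R^-1 : R) < e / 2.
  have e2 : 0 < e / 2 by rewrite divr_gt0.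
  have [k _ hk] := near_infty_natSinv_lt (PosNum e2).
  by exists k; apply: hk => /=.
have k0 : (0 : R) < k.+1%:R^-1 by rewrite invr_gt0 ltr0n.
have ex (i : 'I_m) : exists q : rat, ratr q \in `]x ord0 i - k.+1%:R^-1, x ord0 i + k.+1%:R^-1[.
  by apply: rat_in_itvoo; rewrite ltrBlDr -addrA ltrDl addr_gt0.
have [q hq] := choice ex.
have qx : ball (map_mx (ratr : rat -> R) (\row_i q i)) k.+1%:R^-1 x.
  split => // i j; rewrite ord1 !mxE /ball/= ltr_norml.
  move: (hq j) k0; rewrite in_itv/=; move: (k.+1%:R^-1) => c /andP[? ?] ?.
  by apply/andP; split; lra.
exists (\row_i q i), k; split => // y qy; apply: eU.
have -> : e = e / 2 + e / 2 by lra.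
apply: (@ball_triangle _ _ (map_mx (ratr : rat -> R) (\row_i q i))).
  by apply: ball_sym; exact: le_ball (ltW ke) _ qx.
exact: le_ball (ltW ke) _ qy.
Qed.

(* The complement of the support is a countable union of null rational balls. *)
Lemma measure_support_full (P : probability (borel R m) R) X :
  closed X -> measure_support P = X -> P X = 1%E.
Proof.
move=> cX PX.
pose B (i : 'rV[rat]_m * nat) : set 'rV[R]_m :=
  ball (map_mx (ratr : rat -> R) i.1) i.2.+1%:R^-1.
have oB i : open (B i) by apply: ball_open; rewrite invr_gt0 ltr0n.
(* Enumeration of the rational balls of measure zero; all other codes yield the empty set. *)
pose F (j : nat) : set (borel R m) :=
  if @choice.unpickle ('rV[rat]_m * nat)%type j is Some i then
    if P (B i) == 0%E then B i else set0
  else set0.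
have F0 j : P.-negligible (F j).
  rewrite /F; case: (choice.unpickle j) => [i|]; last exact: negligible_set0.
  have [Bi0|_] := eqVneq (P (B i)) 0%E; last exact: negligible_set0.
  by exists (B i); split => //; exact: open_borel.
have mXC : measurable (~` X : set (borel R m)) by apply: measurableC; exact: closed_borel.
have sub : ~` X `<=` \bigcup_j F j.
  move=> x; rewrite -PX /= => /existsNP[U /not_implyP[oU /not_implyP[Ux /negP]]].
  rewrite -leNgt => U0; have [q [k [qx qU]]] := exists_rat_ball oU Ux.
  exists (choice.pickle (q, k)) => //; rewrite /F choice.pickleK.
  have : (P (B (q, k)) <= P U)%E.
    by apply: le_measure => //; rewrite inE; exact: open_borel.
  move=> /le_trans/(_ U0); rewrite measure_le0 => /eqP ->.
  by rewrite eqxx.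
have XC0 : P (~` X) = 0%E.
  apply: measure_negligible => //.
  apply: (@negligibleS _ (borel R m) _ P (\bigcup_j F j)); first exact: sub.
  exact: negligible_bigcup.
by rewrite -[X]setCK probability_setC// XC0// sube0.
Qed.

Lemma fsbig_ordT (k : nat) (u : 'I_k -> \bar R) :
  (\sum_(i \in [set: 'I_k]) u i = \sum_(i < k) u i)%E.
Proof.
rewrite -big_enum [in RHS]fsbig_seq ?enum_uniq//.
by congr (\sum_(i \in _) _)%E; apply/seteqP; split => i //= _; rewrite mem_enum.
Qed.

Lemma measure_bigcup_ord_le d (T : measurableType d) (P : probability T R) (k : nat)
    (F : 'I_k -> set T) (c : R) : (forall i, measurable (F i)) ->
  (forall i, P (F i) <= c%:E)%E ->
  (P (\bigcup_(i in [set: 'I_k]) F i) <= (k%:R * c)%:E)%E.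
Proof.
move=> mF Fc; have fin : finite_set [set: 'I_k] by exact: finite_finset.
apply: (@le_trans _ _ (\sum_(i \in [set: 'I_k]) P (F i))%E).
  by apply: content_sub_fsum => //; exact: fin_bigcup_measurable.
rewrite fsbig_ordT (le_trans (lee_sum _ (fun i _ => Fc i)))//.
by rewrite sumEFin sumr_const card_ord mulr_natl.
Qed.

End BorelSets.

(** * Packings and nets *)

Section Packing.
Context {R : realType} {m : nat}.
Variables (X : set 'rV[R]_m) (P : probability (borel R m) R) (a b r : R).
Hypotheses (a0 : 0 < a) (r0 : 0 < r) (sX : standard X P a b).

Definition packing (k : nat) (x : 'I_k -> 'rV[R]_m) : Prop :=
  (forall i, X (x i)) /\ forall i j, i != j -> 2 * r < enorm (x i - x j).

(** The balls of radius [r] about the points are disjoint by separation, and their total mass is at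
    most 1. *)
Lemma packing_bound (k : nat) (x : 'I_k -> 'rV[R]_m) : packing x ->
  k%:R * Num.min (a * r `^ b) 1 <= 1.
Proof.
move=> [xX xsep]; rewrite -lee_fin.
have mB i : measurable (closed_eball (x i) r : set (borel R m)).
  by apply: closed_borel; exact: closed_eball_closed.
apply: (@le_trans _ _ (P (\bigcup_(i in [set: 'I_k]) closed_eball (x i) r))); last first.
  by apply: probability_le1; apply: fin_bigcup_measurable => //; exact: finite_finset.
rewrite measure_fin_bigcup//; [|exact: finite_finset|].
  rewrite fsbig_ordT; apply: (@le_trans _ _ (\sum_(i < k) (Num.min (a * r `^ b) 1)%:E)%E).
    by rewrite sumEFin sumr_const card_ord mulr_natl.
  by apply: lee_sum => i _; exact: sX.
move=> i j _ _ [y [/= yi yj]]; apply/eqP/negP => /negP ij; have := xsep _ _ ij.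
apply/negP; rewrite -leNgt (le_trans (enorm_triangle y _ _))//.
by rewrite mulr_natl mulr2n (enormB (x i)); exact: lerD.
Qed.

(** [packing_bound] limits the size of packings, so there is a largest one; a point farther than
    [2 * r] from all its members could be added to it. *)
Lemma exists_net : exists (k : nat) (x : 'I_k -> 'rV[R]_m),
  packing x /\ forall y, X y -> exists i, enorm (y - x i) <= 2 * r.
Proof.
pose c := Num.min (a * r `^ b) 1.
have c0 : 0 < c by rewrite lt_min ltr01 andbT mulr_gt0// powR_gt0.
pose p (k : nat) := `[< exists x : 'I_k -> 'rV[R]_m, packing x >].
have p0 : exists k, p k.
  by exists 0%N; apply/asboolP; exists (fun=> 0); split; [case|case].
have pub k : p k -> (k <= Num.truncn c^-1)%N.
  move=> /asboolP[x /packing_bound]; rewrite -ler_pdivlMr// mul1r => h.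
  by rewrite truncn_ge_nat// invr_ge0 ltW.
have [k /asboolP[x px] kmax] := ex_maxnP p0 pub.
exists k, x; split => // y Xy; apply: contrapT => /forallNP far.
suff /kmax : p k.+1 by rewrite ltnn.
have [xX xsep] := px.
apply/asboolP; exists (fun i => if unlift ord0 i is Some j then x j else y); split.
  by move=> i; case: unliftP.
have far' i : 2 * r < enorm (y - x i) by rewrite ltNge; apply/negP; exact: far.
move=> i j; case: unliftP => [i' ->|->]; case: unliftP => [j' ->|->].
- by move=> ij; apply: xsep; apply: contra_neq ij => ->.
- by move=> _; rewrite enormB.
- by move=> _.
- by rewrite eqxx.
Qed.

End Packing.

(** * Probability that the sample is dense *)

Section Sampling.
Context {R : realType} {m : nat} {d : measure_display} {Omega : measurableType d}.
Variables (X : set 'rV[R]_m) (P : probability (borel R m) R) (a b : R).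
Variables (Pr : probability Omega R) (n : nat) (Z : 'I_n -> {RV Pr >-> borel R m}).
Hypothesis sX : standard X P a b.
Hypothesis iidZ : iid_sample P Z.

Definition misses (B : set 'rV[R]_m) : set Omega :=
  \bigcap_(j in [set: 'I_n]) (Z j @^-1` (~` B)).

Lemma measurable_preimage j (A : set (borel R m)) : measurable A ->
  measurable (Z j @^-1` A).
Proof. by move=> mA; exact: measurable_funPTI. Qed.

Lemma misses_measurable (B : set (borel R m)) : measurable B ->
  measurable (misses B).
Proof.
move=> mB; apply: fin_bigcap_measurable => [|j _]; first exact: finite_finset.
by apply: measurable_preimage; exact: measurableC.
Qed.

Lemma misses_ball_le x s : X x -> 0 < s ->
  (Pr (misses (closed_eball x s)) <= ((1 - Num.min (a * s `^ b) 1) ^+ n)%:E)%E.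
Proof.
move=> Xx s0; have [indep law] := iidZ.
have mB : measurable (closed_eball x s : set (borel R m)).
  by apply: closed_borel; exact: closed_eball_closed.
have mC := measurableC mB.
rewrite /misses; have -> : [set: 'I_n] = [set` [set: 'I_n]%SET].
  by apply/seteqP; split => j //= _; rewrite inE.
rewrite (indep [set: 'I_n]%SET (fun=> ~` closed_eball x s))//.
under eq_bigr do rewrite law//.
have PC1 := probability_setC P mB.
set q := fine (P (~` closed_eball x s)).
have qE : P (~` closed_eball x s) = q%:E by rewrite fineK// fin_num_measure.
have q0 : 0 <= q by rewrite fine_ge0.
rewrite (eq_bigr (fun=> q%:E)) => [|j _]; last exact: qE.
rewrite -(big_morph EFin EFinM erefl) prodr_const cardsT card_ord lee_fin.
have := sX Xx s0; rewrite -[P (closed_eball x s)]fineK ?fin_num_measure//.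
move: PC1; rewrite qE -[P (closed_eball x s)]fineK ?fin_num_measure// -EFinB => -[qE'].
rewrite lee_fin => h; rewrite lerXn2r ?nnegrE//; last by rewrite qE' lerB.
by rewrite subr_ge0 ge_min lexx orbT.
Qed.

(** From [1 - u <= expR (- u)]. When the minimum is capped at 1, the left side is [0 ^+ n], which
    vanishes as [n] is positive. *)
Lemma miss_bound_le_expR s : 0 < a -> 0 < s -> (0 < n)%N ->
  (1 - Num.min (a * s `^ b) 1) ^+ n <= expR (- a * s `^ b * n%:R).
Proof.
move=> a0 s0 n0; have [h|h] := leP (a * s `^ b) 1; last first.
  by rewrite subrr expr0n gtn_eqF// expR_ge0.
rewrite expRM_natr lerXn2r ?nnegrE ?expR_ge0 ?subr_ge0//.
by rewrite mulNr; exact: expR_ge1Dx.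
Qed.

Definition good_sample (delta : R) (omega : Omega) : Prop :=
  (forall j, X (Z j omega)) /\
  forall x, X x -> exists j, enorm (x - Z j omega) <= delta.

Lemma good_sample_prob delta : closed X -> measure_support P = X ->
  0 < a -> 0 < b -> (0 < n)%N -> 0 < delta ->
  prob_ge Pr [set omega | good_sample delta omega] (1 - alpha a b n delta).
Proof.
move=> cX PX a0 b0 n0 d0.
have r0 : 0 < delta / 4 by rewrite divr_gt0.
have s0 : 0 < delta / 2 by rewrite divr_gt0.
(* The radius [delta / 4] gives a net at scale [delta / 2]; a sample point in each ball of radius
   [delta / 2] around it then brings the total to [delta]. The size of this packing accounts for the
   factor before the exponential in [alpha]. *)
have [k [x [pk net]]] := exists_net a0 r0 sX.
have kbound := packing_bound r0 sX pk.
have [xX _] := pk.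
pose s := delta / 2.
have mX : measurable (X : set (borel R m)) by exact: closed_borel.
pose D i := misses (closed_eball (x i) s).
have mD i : measurable (D i).
  by apply: misses_measurable; apply: closed_borel; exact: closed_eball_closed.
(* Sample points lie in [X] only almost surely, so these null events are added to the exceptional
   set. *)
pose N j := Z j @^-1` (~` X).
have mN j : measurable (N j) by apply: measurable_preimage; exact: measurableC.
have N0 j : (Pr (N j) <= 0%:E)%E.
  have [_ law] := iidZ; rewrite law; last exact: measurableC.
  by rewrite probability_setC// measure_support_full// subee.
pose c := (1 - Num.min (a * s `^ b) 1) ^+ n.
have Dc i : (Pr (D i) <= c%:E)%E by exact: misses_ball_le.
pose C := (\bigcup_(j in [set: 'I_n]) N j) `|` (\bigcup_(i in [set: 'I_k]) D i).
have mC1 : measurable (\bigcup_(j in [set: 'I_n]) N j).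
  by apply: fin_bigcup_measurable => //; exact: finite_finset.
have mC2 : measurable (\bigcup_(i in [set: 'I_k]) D i).
  by apply: fin_bigcup_measurable => //; exact: finite_finset.
have mC : measurable C by exact: measurableU.
have PC : (Pr C <= (k%:R * c)%:E)%E.
  apply: le_trans (measureU2 _ _ _) _ => //.
  rewrite -[leRHS]add0e; apply: leeD; last exact: measure_bigcup_ord_le.
  by apply: le_trans (measure_bigcup_ord_le (c := 0) mN N0) _; rewrite mulr0.
exists (~` C); split; first exact: measurableC.
- move=> omega; rewrite /C setCU !setC_bigcup => -[hN hD]; split.
    by move=> j; have := hN j I; rewrite /N /setC/= => /contrapT.
  move=> y Xy; have [i yi] := net y Xy.
  have /existsNP[j /not_implyP[_]] := hD i I.
  rewrite /= /setC/= => /contrapT zi; exists j.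
  rewrite (le_trans (enorm_triangle (x i) _ _))// (enormB (x i)).
  by rewrite /closed_eball/= /s in zi; lra.
have Cfin : Pr C \is a fin_num by exact: fin_num_measure.
rewrite probability_setC// -(fineK Cfin) -EFinB lee_fin lerD2l lerN2.
have PC1 : fine (Pr C) <= 1 by rewrite -lee_fin fineK//; exact: probability_le1.
rewrite /alpha le_min PC1/=.
have PCk : fine (Pr C) <= k%:R * c by rewrite -lee_fin fineK.
apply: le_trans PCk _.
have cexp : c <= expR (- a * s `^ b * n%:R) by exact: miss_bound_le_expR.
have ad0 : 0 < a * delta `^ b by rewrite mulr_gt0// powR_gt0.
have K0 : 0 <= 4 `^ b / (a * delta `^ b) by rewrite divr_ge0 ?powR_ge0// ltW.
have c0 : 0 <= c.
  by rewrite exprn_ge0// subr_ge0 ge_min lexx orbT.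
have sr : (delta / 4) `^ b <= s `^ b.
  by apply: ge0_ler_powR; rewrite ?nnegrE ?ltW// /s; lra.
(* If the mass bound at radius [delta / 4] is capped at 1, so is the one at radius [delta / 2], and
   [c] vanishes since [n] is positive. Otherwise [kbound] is uncapped and bounds [k] by the
   prefactor of [alpha]. *)
move: kbound; have [h|h] := leP (a * (delta / 4) `^ b) 1; last first.
  have -> : c = 0.
    rewrite /c (_ : Num.min _ _ = 1) ?subrr ?expr0n ?gtn_eqF//.
    apply/min_idPr; rewrite ltW// (lt_le_trans h)// ler_pM2l//.
  by move=> _; rewrite mulr0 mulr_ge0// expR_ge0.
have -> : a * (delta / 4) `^ b = (4 `^ b / (a * delta `^ b))^-1.
  have -> : delta `^ b = 4 `^ b * (delta / 4) `^ b.
    by rewrite -powRM ?ltW//; congr (_ `^ _); field.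
  have p4 : 4 `^ b != 0 :> R by rewrite gt_eqF// powR_gt0.
  by rewrite invf_div; field.
rewrite ler_pdivrMr => [|]; last first.
  by rewrite divr_gt0// powR_gt0.
rewrite mul1r => kK; apply: ler_pM => //.
Qed.

End Sampling.

Theorem corollary5p2 (R : realType) (m : nat) (X : set 'rV[R]_m)
    (f : 'rV[R]_m -> R) (w : R -> R)
    (P : probability (borel R m) R) (a b : R)
    (d : measure_display) (Omega : measurableType d) (Pr : probability Omega R)
    (n : nat) (Z : 'I_n -> {RV Pr >-> borel R m}) (delta : R) :
  compact X ->
  (forall x y, X x -> X y -> (intrinsic_dist X x y < +oo)%E) ->
  {within X, continuous f} ->
  constructible (sigL X f) ->
  modulus_of_continuity X f w ->
  measure_support P = X ->
  0 < a -> 0 < b -> standard X P a b ->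
  (0 < n)%N -> iid_sample P Z ->
  (0 < reach X)%E ->
  0 < delta -> (delta%:E < reach X)%E ->
  let S omega : set 'rV[R]_m := range (fun i => Z i omega) in
  let dist omega := interleaving_dist (reeb_precosheaf (sigL X f))
                                      (pl_reeb (S omega) delta f) in
  prob_ge Pr [set omega | (dist omega <= (w (eta (reach X) delta))%:E)%E]
    (1 - alpha a b n delta) /\
  (lipschitz1 X f -> ((2 * delta)%:E < reach X)%E ->
   prob_ge Pr [set omega | (dist omega <= (2 * pi / 3 * delta)%:E)%E]
     (1 - alpha a b n delta)).
Proof.
move=> cX dfin cf _ mw PX a0 b0 sX n0 iidZ _ d0 dr S dist.
have clX : closed X by apply: compact_closed => //; exact: norm_hausdorff.
have [A [mA Agood PA]] := good_sample_prob sX iidZ clX PX a0 b0 n0 d0.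
have dist_le w' omega : modulus_of_continuity X f w' -> A omega ->
    (dist omega <= (w' (eta (reach X) delta))%:E)%E.
  move=> mw' /Agood[SX dense]; apply: interleaving_dist_le => //.
  - exact: finite_image.
  - by move=> _ [j _ <-]; exact: SX.
  - by move=> x /dense[j xj]; exists (Z j omega) => //; exists j.
split; first by exists A; split => // omega Aomega; exact: dist_le.
(* The event [A] does not depend on the modulus, so it also serves the identity, which is a modulus
   for a 1-Lipschitz [f]. *)
move=> lip d2r; exists A; split => // omega Aomega.
have mid := lipschitz1_modulus dfin lip.
apply: le_trans (dist_le _ _ mid Aomega) _.
by rewrite lee_fin; exact: eta_le_linear.
Qed.
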